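(* Let $\mathcal U$ be a unitary channel. Then for every $m\ge1$, $$\mathcal F(\tilde{\mathbb G},\mathcal U\mathbb G\mathcal U^\dagger,m)=\frac1d+\frac{d-1}{d}\big(C(\mathcal U)p^m+D(m,\mathcal U)\big),$$ where $$C(\mathcal U)=\frac{\langle\boldsymbol\Pi_{\rm tr},\boldsymbol{\mathcal A}_\infty\boldsymbol{\mathcal U}\rangle}{\|\boldsymbol\Pi_{\rm tr}\|_F^2}\cdot\frac{\langle\boldsymbol\Pi_{\rm tr},\boldsymbol{\mathcal U}^\dagger\boldsymbol{\mathcal B}_\infty\rangle}{\|\boldsymbol\Pi_{\rm tr}\|_F^2}\cdot\frac{\|\boldsymbol\Pi_{\rm tr}\|_F^2}{\langle\boldsymbol\Pi_{\rm tr},\boldsymbol{\mathcal A}_\infty\boldsymbol{\mathcal B}_\infty\rangle}$$ (equivalently $C(\mathcal U)=\frac{\langle\boldsymbol{\mathcal A}_\infty^T,\boldsymbol{\mathcal U}\rangle}{\|\boldsymbol\Pi_{\rm tr}\|_F^2}\frac{\langle\boldsymbol{\mathcal U},\boldsymbol{\mathcal B}_\infty\rangle}{\|\boldsymbol\Pi_{\rm tr}\|_F^2}\big(\frac{\langle\boldsymbol{\mathcal A}_\infty^T,\boldsymbol{\mathcal B}_\infty\rangle}{\|\boldsymbol\Pi_{\rm tr}\|_F^2}\big)^{-1}$) and $$D(m,\mathcal U)=\sqrt{1-a(\mathcal U)^2}\sqrt{1-b(\mathcal U)^2}\;w(\mathcal U)^\dagger\boldsymbol\Delta^m v(\mathcal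 U).$$
   Context: $\mathbb G$ is a finite group of unitary channels on a $d$-dimensional system forming a unitary 2-design (as in randomized benchmarking); $\tilde{\mathbb G}=\{\tilde{\mathcal G}\}$ is its noisy implementation (CPTP maps, possibly gate-dependent), a small perturbation of $\mathbb G$. Bold symbols are real Liouville matrices (orthonormal Hermitian operator basis) of linear maps; $\Pi_{\rm tr}(\rho)=\rho-\mathbb I\operatorname{tr}\rho/d$; $\langle M_1,M_2\rangle=\operatorname{tr}(M_1^\dagger M_2)$ and $\|\cdot\|_F$ is the induced Frobenius norm. For $A=\sum_{j,k}a_{jk}e_je_k^T$, ${\rm vec}(A)=\sum_{j,k}a_{jk}e_k\otimes e_j$. Expectations are over independent uniformly random $\mathcal G_1,\dots,\mathcal G_m\in\mathbb G$; products $\mathcal X_{m:1}=\mathcal X_m\cdots\mathcal X_1$. Average fidelity: ${\rm F}(\tilde{\mathcal C},\mathcal C)=\int\operatorname{tr}[\tilde{\mathcal C}(\psi)^\dagger\mathcal C(\psi)]d\psi$ over uniformly random pure states; gate-set circuit fidelity $\mathcal F(\tilde{\mathbb G},\mathcal U\mathbb G\mathcal U^\dagger,m)=\mathbb E[{\rm F}(\tilde{\mathcal G}_{m:1},\mathcal U\mathcal G_{m:1}\mathcal U^\dagger)]$. Let $\boldsymbol{\mathcal G}_{\rm tr}=\boldsymbol{\mathcal G}\boldsymbol\Pi_{\rm tr}$, $\boldsymbol{\mathcal T}=\mathbb E[\boldsymbol{\mathcal G}_{\rm tr}\otimes\tilde{\boldsymbol{\mathcal G}}]$, and $p$ its largest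 eigenvalue. Let $\boldsymbol{\mathcal A}_\infty=\lim_m p^{-m}\mathbb E[(\boldsymbol{\mathcal G}_{{\rm tr},m:1})^\dagger\boldsymbol\Pi_{\rm tr}\tilde{\boldsymbol{\mathcal G}}_{m:1}]$ and $\boldsymbol{\mathcal B}_\infty=\lim_m p^{-m}\mathbb E[\tilde{\boldsymbol{\mathcal G}}_{m:1}\boldsymbol\Pi_{\rm tr}(\boldsymbol{\mathcal G}_{{\rm tr},m:1})^\dagger]$; ${\rm vec}^\dagger(\boldsymbol{\mathcal A}_\infty^T)$ and ${\rm vec}(\boldsymbol{\mathcal B}_\infty)$ are left and right $p$-eigenvectors of $\boldsymbol{\mathcal T}$, and $\boldsymbol\Delta:=\boldsymbol{\mathcal T}-p\,{\rm vec}(\boldsymbol{\mathcal B}_\infty){\rm vec}^\dagger(\boldsymbol{\mathcal A}_\infty^T)/\langle\boldsymbol{\mathcal A}_\infty^T,\boldsymbol{\mathcal B}_\infty\rangle$. Define $a(\mathcal U)=\frac{\langle\boldsymbol{\mathcal A}_\infty^T,\boldsymbol{\mathcal U}\rangle}{\|\boldsymbol\Pi_{\rm tr}\|_F^2}\big(\frac{\|\boldsymbol{\mathcal A}_\infty\|_F^2}{\|\boldsymbol\Pi_{\rm tr}\|_F^2}\big)^{-1/2}$, $b(\mathcal U)=\frac{\langle\boldsymbol{\mathcal U},\boldsymbol{\mathcal B}_\infty\rangle}{\|\boldsymbol\Pi_{\rm tr}\|_F^2}\big(\frac{\|\boldsymbol{\mathcal B}_\infty\|_F^2}{\|\boldsymbol\Pi_{\rm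 tr}\|_F^2}\big)^{-1/2}$, and the unit vectors $w(\mathcal U),v(\mathcal U)$ by ${\rm vec}^\dagger(\boldsymbol{\mathcal U}\boldsymbol\Pi_{\rm tr})/\|\boldsymbol\Pi_{\rm tr}\|_F=a(\mathcal U){\rm vec}^\dagger(\boldsymbol{\mathcal A}_\infty^T)/\|\boldsymbol{\mathcal A}_\infty\|_F+\sqrt{1-a(\mathcal U)^2}\,w(\mathcal U)^\dagger$ and ${\rm vec}(\boldsymbol{\mathcal U}\boldsymbol\Pi_{\rm tr})/\|\boldsymbol\Pi_{\rm tr}\|_F=b(\mathcal U){\rm vec}(\boldsymbol{\mathcal B}_\infty)/\|\boldsymbol{\mathcal B}_\infty\|_F+\sqrt{1-b(\mathcal U)^2}\,v(\mathcal U)$. *)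

(* Defs.v *)
From HB Require Import structures.
From mathcomp Require Import all_boot all_order all_algebra.
From mathcomp Require Import all_classical all_reals all_analysis.
From mathcomp Require Import complex.

Set Implicit Arguments.
Unset Strict Implicit.
Unset Printing Implicit Defensive.
Import Order.TTheory GRing.Theory Num.Theory numFieldNormedType.Exports.
Local Open Scope ring_scope.
Local Open Scope classical_set_scope.

(* Index pairing 'I_(m*n) <-> 'I_m * 'I_n, inverse of mxvec_index.     *)
Definition unpair (m n : nat) (k : 'I_(m * n)) : 'I_m * 'I_n :=
  enum_val (cast_ord (esym (mxvec_cast m n)) k).

(* Kronecker product:  (X (x) Y)_{(i1,i2),(j1,j2)} = X_{i1 j1} Y_{i2 j2},
   with (i1,i2) <-> e_{i1} (x) e_{i2} encoded by mxvec_index/unpair. *)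
Definition kron (T : pzRingType) (n : nat) (X Y : 'M[T]_n) : 'M[T]_(n * n) :=
  \matrix_(a, b) (X (unpair a).1 (unpair b).1 * Y (unpair a).2 (unpair b).2).

(* vec(A) = sum_{j,k} a_{jk} e_k (x) e_j  (column stacking). *)
Definition vecm (T : Type) (n : nat) (A : 'M[T]_n) : 'cV[T]_(n * n) :=
  \col_k A (unpair k).2 (unpair k).1.

Definition mxpow (T : pzRingType) (n : nat) (M : 'M[T]_n) (m : nat) : 'M[T]_n :=
  iter m (mulmx M) 1%:M.

Definition prodL (T : pzRingType) (k n m : nat) (X : 'I_n -> 'M[T]_k)
    (f : {ffun 'I_m -> 'I_n}) : 'M[T]_k :=
  foldl (fun acc i => X (f i) *m acc) 1%:M (enum 'I_m).

(* uniform expectation over independent G_1..G_m (f i = index of G_(i+1)) *)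
Definition Emx (R : realType) (k n m : nat)
    (M : {ffun 'I_m -> 'I_n} -> 'M[R]_k) : 'M[R]_k :=
  ((n%:R ^+ m)^-1) *: \sum_(f : {ffun 'I_m -> 'I_n}) M f.

Definition ipF (R : realType) (k : nat) (M1 M2 : 'M[R]_k) : R := \tr (M1^T *m M2).
Definition normF (R : realType) (k : nat) (M : 'M[R]_k) : R := Num.sqrt (ipF M M).

Section Quantum.
Variable R : realType.
Local Notation C := (R[i]).

Definition adjmx (d : nat) (A : 'M[C]_d) : 'M[C]_d := (map_mx (@conjc R) A)^T.

Definition unitary (d : nat) (U : 'M[C]_d) : Prop := U *m adjmx U = 1%:M.

Definition uchan (d : nat) (U : 'M[C]_d) : 'M[C]_d -> 'M[C]_d :=
  fun rho => U *m rho *m adjmx U.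

Definition lin_map (d : nat) (Phi : 'M[C]_d -> 'M[C]_d) : Prop :=
  forall (a : C) (X Y : 'M[C]_d), Phi (a *: X + Y) = a *: Phi X + Phi Y.

(* complete positivity: the Choi matrix  sum_{a,b} E_ab (x) Phi(E_ab)
   is positive semidefinite (written out entrywise) *)
Definition completely_positive (d : nat) (Phi : 'M[C]_d -> 'M[C]_d) : Prop :=
  forall v : 'I_d -> 'I_d -> C,
    0 <= \sum_(a < d) \sum_(b < d) \sum_(i < d) \sum_(j < d)
           (v a i)^* * Phi (delta_mx a b) i j * v b j.

Definition trace_preserving (d : nat) (Phi : 'M[C]_d -> 'M[C]_d) : Prop :=
  forall X, \tr (Phi X) = \tr X.

Definition CPTP (d : nat) (Phi : 'M[C]_d -> 'M[C]_d) : Prop :=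
  [/\ lin_map Phi, completely_positive Phi & trace_preserving Phi].

Definition pitr (d : nat) : 'M[C]_d -> 'M[C]_d :=
  fun rho => rho - (\tr rho / d%:R) *: 1%:M.

Definition herm_onb (d : nat) (B : 'I_(d * d) -> 'M[C]_d) : Prop :=
  (forall i, adjmx (B i) = B i) /\
  (forall i j, \tr (adjmx (B i) *m B j) = (i == j)%:R).

Definition liou (d : nat) (B : 'I_(d * d) -> 'M[C]_d)
    (Phi : 'M[C]_d -> 'M[C]_d) : 'M[R]_(d * d) :=
  \matrix_(j, k) complex.Re (\tr (adjmx (B j) *m Phi (B k))).

Definition chain (d n m : nat) (Phi : 'I_n -> 'M[C]_d -> 'M[C]_d)
    (f : {ffun 'I_m -> 'I_n}) : 'M[C]_d -> 'M[C]_d :=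
  foldl (fun acc i => Phi (f i) \o acc) id (enum 'I_m).

Definition mxcode (d : nat) := ((d * d).-tuple (R * R))%type.

Definition toMx (d : nat) (x : mxcode d) : 'M[C]_d :=
  \matrix_(i, j) (let p := tnth x (mxvec_index i j) in Complex p.1 p.2).

Definition fromMx (d : nat) (M : 'M[C]_d) : mxcode d :=
  [tuple (let ij := unpair k in (complex.Re (M ij.1 ij.2), complex.Im (M ij.1 ij.2))) | k < d * d].

Definition haar (d : nat) (nu : probability (mxcode d) R) : Prop :=
  nu [set x | unitary (toMx x)] = 1%E /\
  (forall V : 'M[C]_d, unitary V ->
     forall A : set (mxcode d), measurable A ->
       nu ((fun x => fromMx (V *m toMx x)) @^-1` A) = nu A).

Definition cint (d : nat) (nu : probability (mxcode d) R) (f : mxcode d -> C) : C :=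
  Complex (fine (\int[nu]_x (complex.Re (f x))%:E)%E) (fine (\int[nu]_x (complex.Im (f x))%:E)%E).

Definition unitary_2design (d n : nat) (nu : probability (mxcode d) R)
    (Ug : 'I_n -> 'M[C]_d) : Prop :=
  forall X : 'M[C]_(d * d),
    (n%:R)^-1 *: \sum_(i < n) (kron (Ug i) (Ug i) *m X *m adjmx (kron (Ug i) (Ug i)))
    = \matrix_(a, b) cint nu (fun x =>
         (kron (toMx x) (toMx x) *m X *m adjmx (kron (toMx x) (toMx x))) a b).

(* uniformly random pure state psi = U |0><0| U^dagger, U Haar *)
Definition pure_of (d : nat) (x : mxcode d) : 'M[C]_d :=
  toMx x *m pid_mx 1 *m adjmx (toMx x).

Definition avg_fid (d : nat) (nu : probability (mxcode d) R)
    (Phi Psi : 'M[C]_d -> 'M[C]_d) : R :=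
  fine (\int[nu]_x
          (complex.Re (\tr (adjmx (Phi (pure_of x)) *m Psi (pure_of x))))%:E)%E.

Definition circuit_fid (d n : nat) (nu : probability (mxcode d) R)
    (Gt : 'I_n -> 'M[C]_d -> 'M[C]_d) (Ug : 'I_n -> 'M[C]_d)
    (U : 'M[C]_d) (m : nat) : R :=
  (n%:R ^+ m)^-1 * \sum_(f : {ffun 'I_m -> 'I_n})
     avg_fid nu (chain Gt f)
       (uchan U \o chain (fun i => uchan (Ug i)) f \o uchan (adjmx U)).

End Quantum.

(* Main.v *)
(* With Z = U Pi in Liouville form, the circuit fidelity is a quadratic form in
   powers of the twirl:

     F(m) = 1/d + vec(Z)^T T^m vec(Z) / (d (d + 1)).

   The second moment of a Haar-random pure state psi, E[psi (x) psi] =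
   (I + SWAP) / (d (d + 1)), follows from invariance: diagonal phases kill all
   unbalanced moments of the first column of a Haar unitary, reflections in two
   coordinates give E|u_a|^4 = 2 E|u_a u_b|^2, and normalization fixes the
   constant. Hence the average fidelity of Phi (trace preserving) and Psi (unital)
   is (d + tr(Phi^T Psi)) / (d (d + 1)); averaging over the circuit turns the trace
   into the quadratic form, since E[G_tr,m:1 (x) G~_m:1] = T^m.

   The limits defining A_inf and B_inf are p^-m (T^T)^m vec(Pi) and p^-m T^m vec(Pi),
   so their vectorizations are left and right p-eigenvectors of T. Deflating by them
   gives T^m = Delta^m + p^m vec(B) vec(A^T)^T / <A^T, B> for m >= 1, with Delta
   annihilating both eigenvectors; the cross terms in the decompositions of vec(Z)
   along w and v therefore vanish. *)

Require Import Defs.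
From HB Require Import structures.
From mathcomp Require Import all_boot all_order all_algebra.
From mathcomp Require Import all_classical all_reals all_analysis.
From mathcomp Require Import measurable_realfun.
From mathcomp Require Import complex.
From mathcomp Require Import ring lra.
Import Order.TTheory GRing.Theory Num.Theory numFieldNormedType.Exports.
Local Open Scope ring_scope.
Local Open Scope classical_set_scope.

Set Implicit Arguments.
Unset Strict Implicit.
Unset Printing Implicit Defensive.

(** * Haar moments *)

Section ComplexParts.
Variable R : realType.
Implicit Types x y : R[i].

Lemma ReD x y : complex.Re (x + y) = complex.Re x + complex.Re y.
Proof. by case: x; case: y. Qed.

Lemma ImD x y : complex.Im (x + y) = complex.Im x + complex.Im y.
Proof. by case: x; case: y. Qed.

Lemma ReM x y : complex.Re (x * y)
  = complex.Re x * complex.Re y - complex.Im x * complex.Im y.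
Proof. by case: x; case: y. Qed.

Lemma ImM x y : complex.Im (x * y)
  = complex.Re x * complex.Im y + complex.Im x * complex.Re y.
Proof. by case: x; case: y. Qed.

Lemma ReJ x : complex.Re (conjc x) = complex.Re x.
Proof. by case: x. Qed.

Lemma ImJ x : complex.Im (conjc x) = - complex.Im x.
Proof. by case: x. Qed.

Lemma Re_sum (I : Type) (r : seq I) (P : pred I) (F : I -> R[i]) :
  complex.Re (\sum_(i <- r | P i) F i) = \sum_(i <- r | P i) complex.Re (F i).
Proof. exact: (big_morph _ ReD). Qed.

Lemma sum_dirac (I : finType) (i : I) (F : I -> R[i]) :
  \sum_j (j == i)%:R * F j = F i.
Proof.
rewrite (bigD1 i) //= eqxx mul1r big1 ?addr0 // => j /negPf ->.
by rewrite mul0r.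
Qed.

Lemma complex_eta x : Complex (complex.Re x) (complex.Im x) = x.
Proof. by case: x. Qed.

Lemma real_conjc x : conjc x = x -> x = ((complex.Re x)%:C)%C.
Proof.
by case: x => a b [] /eqP; rewrite eqNr => /eqP ->.
Qed.

End ComplexParts.

(** * Adjoints and unitary matrices *)

Section Adjoint.
Variable R : realType.
Variable d : nat.
Implicit Types A B : 'M[R[i]]_d.

Lemma adjmxE A i j : adjmx A i j = conjc (A j i).
Proof. by rewrite !mxE. Qed.

Lemma adjmxK A : adjmx (adjmx A) = A.
Proof. by apply/matrixP=> i j; rewrite !adjmxE conjcK. Qed.

Lemma adjmxB A B : adjmx (A - B) = adjmx A - adjmx B.
Proof. by apply/matrixP=> i j; rewrite !mxE rmorphB. Qed.

Lemma adjmxZ a A : adjmx (a *: A) = conjc a *: adjmx A.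
Proof. by apply/matrixP=> i j; rewrite !mxE rmorphM. Qed.

Lemma adjmxM A B : adjmx (A *m B) = adjmx B *m adjmx A.
Proof. by rewrite /adjmx map_mxM trmx_mul. Qed.

Lemma adjmx1 : adjmx (1%:M : 'M[R[i]]_d) = 1%:M.
Proof. by rewrite /adjmx map_mx1 trmx1. Qed.

Lemma adjmx_sum (I : Type) (r : seq I) (P : pred I) (F : I -> 'M[R[i]]_d) :
  adjmx (\sum_(i <- r | P i) F i) = \sum_(i <- r | P i) adjmx (F i).
Proof. by rewrite /adjmx !raddf_sum. Qed.

Lemma mxtrace_adj A : \tr (adjmx A) = conjc (\tr A).
Proof. by rewrite /mxtrace rmorph_sum; apply: eq_bigr => i _; rewrite adjmxE. Qed.

Lemma unitary_adj A : unitary A -> unitary (adjmx A).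
Proof. by move=> hA; rewrite /unitary adjmxK; apply: mulmx1C. Qed.

Lemma adjmx_real (M : 'M[R]_d) :
  adjmx (map_mx (real_complex R) M) = map_mx (real_complex R) M^T.
Proof. by apply/matrixP=> i j; rewrite adjmxE !mxE conjc_real. Qed.

Lemma unitary_sum A i j : unitary A ->
  \sum_k A i k * conjc (A j k) = (i == j)%:R.
Proof.
move=> /matrixP/(_ i j); rewrite !mxE => <-.
by apply: eq_bigr => k _; rewrite adjmxE.
Qed.

Lemma unitary_bound A i j : unitary A ->
  `|complex.Re (A i j)| <= 1 /\ `|complex.Im (A i j)| <= 1.
Proof.
move=> /(@unitary_sum _ i i)/(congr1 (@complex.Re R)).
rewrite eqxx Re_sum (bigD1 j) //= ReM ReJ ImJ mulrN opprK -!expr2 => h.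
have h0 : 0 <= \sum_(k | k != j) complex.Re (A i k * conjc (A i k)).
  by apply: sumr_ge0 => k _; rewrite ReM ReJ ImJ mulrN opprK -!expr2 addr_ge0 ?sqr_ge0.
by split; rewrite ler_norml; apply/andP; split; nra.
Qed.

End Adjoint.

(** * Haar integration of functions of the matrix entries *)

Section Integration.
Variables (R : realType) (d : nat) (nu : probability (mxcode R d) R).
Implicit Types f g : mxcode R d -> R[i].

(* Polynomials in the entries are bounded only on the unitary matrices, a set of
   full measure in the space [mxcode] of all matrices. *)
Definition tame f : Prop :=
  [/\ measurable_fun [set: mxcode R d] (fun x => complex.Re (f x)),
      measurable_fun [set: mxcode R d] (fun x => complex.Im (f x))
    & exists M : R, forall x, unitary (toMx x) ->
        `|complex.Re (f x)| <= M /\ `|complex.Im (f x)| <= M].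

Lemma tameD f g : tame f -> tame g -> tame (fun x => f x + g x).
Proof.
move=> [f1 f2 [M hM]] [g1 g2 [N hN]]; split.
- by under eq_fun do rewrite ReD; exact: measurable_funD.
- by under eq_fun do rewrite ImD; exact: measurable_funD.
- exists (M + N) => x /[dup] /hM [? ?] /hN [? ?].
  by rewrite ReD ImD; split; apply: (le_trans (ler_normD _ _)); apply: lerD.
Qed.

Lemma tameM f g : tame f -> tame g -> tame (fun x => f x * g x).
Proof.
move=> [f1 f2 [M hM]] [g1 g2 [N hN]]; split.
- by under eq_fun do rewrite ReM; apply: measurable_funB; exact: measurable_funM.
- by under eq_fun do rewrite ImM; apply: measurable_funD; exact: measurable_funM.
- exists (M * N + M * N) => x /[dup] /hM [? ?] /hN [? ?].
  rewrite ReM ImM; split.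
    by apply: (le_trans (ler_normB _ _)); rewrite !normrM; apply: lerD; apply: ler_pM.
  by apply: (le_trans (ler_normD _ _)); rewrite !normrM; apply: lerD; apply: ler_pM.
Qed.

Lemma tame_cst (c : R[i]) : tame (fun=> c).
Proof.
split; [exact: measurable_cst | exact: measurable_cst |].
exists (Num.max `|complex.Re c| `|complex.Im c|) => x _.
by rewrite !le_max !lexx orbT.
Qed.

Lemma tameJ f : tame f -> tame (fun x => conjc (f x)).
Proof.
move=> [f1 f2 [M hM]]; split.
- by under eq_fun do rewrite ReJ.
- by under eq_fun do rewrite ImJ; exact: measurable_funN.
- by exists M => x /hM; rewrite ReJ ImJ normrN.
Qed.

Lemma tame_sum (I : Type) (r : seq I) (F : I -> mxcode R d -> R[i]) :
  (forall i, tame (F i)) -> tame (fun x => \sum_(i <- r) F i x).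
Proof.
move=> hF; elim: r => [|i r IH].
  by under eq_fun do rewrite big_nil; exact: tame_cst.
by under eq_fun do rewrite big_cons; apply: tameD.
Qed.

Lemma tame_entry i j : tame (fun x => toMx x i j).
Proof.
have mt : measurable_fun [set: mxcode R d]
    (fun x : mxcode R d => tnth x (mxvec_index i j)).
  exact: measurable_tnth.
split.
- under eq_fun do rewrite mxE; exact: (measurableT_comp measurable_fst mt).
- under eq_fun do rewrite mxE; exact: (measurableT_comp measurable_snd mt).
- by exists 1 => x; apply: unitary_bound.
Qed.

(** The unitary matrices are the zero set of the measurable function [s], which adds up the squared
    real and imaginary parts of all entries of U U^† - 1. *)
Lemma measurable_unitary : measurable [set x : mxcode R d | unitary (toMx x)].
Proof.
pose e i j (x : mxcode R d) := (toMx x *m adjmx (toMx x)) i j - (i == j)%:R.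
pose s x := \sum_i \sum_j (complex.Re (e i j x) ^+ 2 + complex.Im (e i j x) ^+ 2).
have te i j : tame (e i j).
  apply: tameD; last exact: tame_cst.
  have -> : (fun x : mxcode R d => (toMx x *m adjmx (toMx x)) i j)
          = (fun x => \sum_k toMx x i k * conjc (toMx x j k)).
    by apply/funext => x; rewrite mxE; apply: eq_bigr => k _; rewrite adjmxE.
  apply: tame_sum => k; apply: tameM; first exact: tame_entry.
  exact/tameJ/tame_entry.
have ms : measurable_fun [set: mxcode R d] s.
  apply: measurable_sum => i; apply: measurable_sum => j.
  by have [h1 h2 _] := te i j; apply: measurable_funD; exact: measurable_funX.
have -> : [set x : mxcode R d | unitary (toMx x)] = s @^-1` [set 0].
  apply/seteqP; split => x /=.
    move=> hx; rewrite /s big1 // => i _; rewrite big1 // => j _.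
    by rewrite /e hx mxE subrr /= expr0n /= addr0.
  have g0 i j : 0 <= complex.Re (e i j x) ^+ 2 + complex.Im (e i j x) ^+ 2.
    by rewrite addr_ge0 ?sqr_ge0.
  move=> s0; apply/matrixP => i j; apply/eqP; rewrite -subr_eq0 [X in _ - X]mxE.
  have /(_ i isT) s1 := psumr_eq0P (fun i _ => sumr_ge0 _ (fun j _ => g0 i j)) s0.
  have /(_ j isT) := psumr_eq0P (fun j _ => g0 i j) s1.
  move/eqP; rewrite paddr_eq0 ?sqr_ge0 // !sqrf_eq0 eq_complex => /andP[] /eqP h1 /eqP h2.
  by rewrite -/(e i j x) h1 h2 !eqxx.
by rewrite -[X in measurable X]setTI; apply: ms.
Qed.

Hypothesis hnu : haar nu.

Lemma nu_nonunitary : nu (~` [set x | unitary (toMx x)]) = 0%E.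
Proof.
rewrite probability_setC; last exact: measurable_unitary.
by rewrite hnu.1 subee.
Qed.

(** The non-unitary codes form a null set, so a bound on the unitary ones is enough on the whole
    space. *)
Lemma bounded_on_unitary_integrable (h : mxcode R d -> R) :
  measurable_fun [set: mxcode R d] h ->
  (exists M, forall x, unitary (toMx x) -> `|h x| <= M) ->
  nu.-integrable [set: mxcode R d] (EFin \o h).
Proof.
move=> mh [M hM].
apply/(negligible_integrable (measurableC measurable_unitary) measurableT _ nu_nonunitary).
  exact/measurable_EFinP.
rewrite setTD setCK; apply: measurable_bounded_integrable.
- exact: measurable_unitary.
- by apply: (le_lt_trans (probability_le1 _ measurable_unitary)); rewrite ltry.
- exact: measurable_funTS.
- exists M; split; first exact: num_real.
  by move=> y My x /= /hM /le_trans -> //; exact: ltW.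
Qed.

Lemma tame_integrable f : tame f ->
  nu.-integrable [set: mxcode R d] (EFin \o (fun x => complex.Re (f x))) /\
  nu.-integrable [set: mxcode R d] (EFin \o (fun x => complex.Im (f x))).
Proof.
move=> [f1 f2 [M hM]]; split; apply: bounded_on_unitary_integrable => //.
  by exists M => x /hM [].
by exists M => x /hM [].
Qed.

Lemma cintE f : cint nu f =
  Complex (Rintegral nu setT (fun x => complex.Re (f x)))
          (Rintegral nu setT (fun x => complex.Im (f x))).
Proof. by []. Qed.

Lemma cintD f g : tame f -> tame g ->
  cint nu (fun x => f x + g x) = cint nu f + cint nu g.
Proof.
move=> /tame_integrable[f1 f2] /tame_integrable[g1 g2]; rewrite !cintE.
under eq_Rintegral do rewrite ReD.
under [in X in Complex _ X]eq_Rintegral do rewrite ImD.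
by rewrite !RintegralD.
Qed.

Lemma cintZ (c : R[i]) f : tame f -> cint nu (fun x => c * f x) = c * cint nu f.
Proof.
move=> /tame_integrable[f1 f2]; rewrite !cintE.
have i1 (r : R) : nu.-integrable [set: mxcode R d] (EFin \o (fun x => r * complex.Re (f x))).
  exact: (integrableZl measurableT r f1).
have i2 (r : R) : nu.-integrable [set: mxcode R d] (EFin \o (fun x => r * complex.Im (f x))).
  exact: (integrableZl measurableT r f2).
under eq_Rintegral do rewrite ReM.
under [in X in Complex _ X]eq_Rintegral do rewrite ImM.
by rewrite RintegralB // RintegralD // !RintegralZl //; case: c.
Qed.

Lemma cint_cst (c : R[i]) : cint nu (fun=> c) = c.
Proof.
rewrite cintE !Rintegral_cst // [X in fine X]probability_setT /= !mulr1.
exact: complex_eta.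
Qed.

Lemma cint_sum (I : Type) (r : seq I) (F : I -> mxcode R d -> R[i]) :
  (forall i, tame (F i)) ->
  cint nu (fun x => \sum_(i <- r) F i x) = \sum_(i <- r) cint nu (F i).
Proof.
move=> hF; elim: r => [|i r IH].
  by rewrite big_nil; under eq_fun do rewrite big_nil; exact: cint_cst.
under eq_fun do rewrite big_cons.
by rewrite big_cons cintD // ?IH //; exact: tame_sum.
Qed.

Lemma eq_cint f g : tame f -> tame g ->
  (forall x, unitary (toMx x) -> f x = g x) -> cint nu f = cint nu g.
Proof.
move=> tf tg fg; have [f1 f2] := tame_integrable tf; have [g1 g2] := tame_integrable tg.
have mN := measurableC measurable_unitary.
by rewrite /cint; congr Complex; congr fine;
  rewrite (negligible_integral mN measurableT _ nu_nonunitary) //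
     [RHS](negligible_integral mN measurableT _ nu_nonunitary) //;
  apply: eq_integral => x; rewrite inE setTD setCK => /fg ->.
Qed.

Definition translate (V : 'M[R[i]]_d) (x : mxcode R d) : mxcode R d :=
  fromMx (V *m toMx x).

Lemma fromMxK (M : 'M[R[i]]_d) : toMx (fromMx M) = M.
Proof.
apply/matrixP => i j; rewrite mxE tnth_mktuple /= /unpair /mxvec_index.
by rewrite cast_ordK enum_rankK complex_eta.
Qed.

Lemma toMx_translate V x : toMx (translate V x) = V *m toMx x.
Proof. exact: fromMxK. Qed.

Lemma measurable_translate V : measurable_fun [set: mxcode R d] (translate V).
Proof.
have tV i j : tame (fun x => (V *m toMx x) i j).
  under eq_fun do rewrite mxE.
  by apply: tame_sum => k; apply: tameM; [exact: tame_cst | exact: tame_entry].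
apply/measurable_fun_tnthP => k.
have -> : (@tnth (d * d) _ ^~ k \o translate V) = (fun x =>
   (complex.Re ((V *m toMx x) (unpair k).1 (unpair k).2),
    complex.Im ((V *m toMx x) (unpair k).1 (unpair k).2))).
  by apply/funext => x /=; rewrite tnth_mktuple.
by have [h1 h2 _] := tV (unpair k).1 (unpair k).2; exact: measurable_fun_pair.
Qed.

Lemma tame_translate V f : unitary V -> tame f -> tame (fun x => f (translate V x)).
Proof.
move=> hV [f1 f2 [M hM]]; split.
- exact: (measurableT_comp f1 (measurable_translate V)).
- exact: (measurableT_comp f2 (measurable_translate V)).
- exists M => x hx; apply: hM; rewrite toMx_translate /unitary adjmxM.
  by rewrite mulmxA -(mulmxA V) hx mulmx1.
Qed.

(** Change of variables turns the left side into an integral against the push-forward of [nu], which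
    agrees with [nu] on measurable sets by Haar invariance. *)
Lemma integral_translate V (h : mxcode R d -> R) : unitary V ->
  measurable_fun [set: mxcode R d] h ->
  nu.-integrable [set: mxcode R d] (EFin \o (fun x => h (translate V x))) ->
  Rintegral nu setT (fun x => h (translate V x)) = Rintegral nu setT h.
Proof.
move=> hV mh ih; rewrite /Rintegral; congr fine.
have mt := measurable_translate V.
transitivity (\int[pushforward nu (translate V)]_y (h y)%:E)%E.
  rewrite integral_pushforward //; first exact/measurable_EFinP.
by apply: eq_measure_integral => A mA _; exact: hnu.2.
Qed.

Lemma cint_translate V f : unitary V -> tame f ->
  cint nu (fun x => f (translate V x)) = cint nu f.
Proof.
move=> hV tf; have [h1 h2] := tame_integrable (tame_translate hV tf).
have [m1 m2 _] := tf; rewrite !cintE; congr Complex.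
  exact: (integral_translate (h := fun x => complex.Re (f x))).
exact: (integral_translate (h := fun x => complex.Im (f x))).
Qed.

End Integration.

(** * Fourth moments of a column of a Haar unitary *)

Section HaarMoments.
Variables (R : realType) (d : nat) (nu : probability (mxcode R d) R).
Hypothesis hnu : haar nu.
Variable o : 'I_d.
Local Notation u := (fun i (x : mxcode R d) => toMx x i o).
Local Notation mono i j k l := (fun x : mxcode R d =>
  toMx x i o * conjc (toMx x j o) * (toMx x k o * conjc (toMx x l o))).

Definition moment (i j k l : 'I_d) : R[i] := cint nu (mono i j k l).

Lemma tame_mono i j k l : tame (mono i j k l).
Proof.
by apply: tameM; (apply: tameM; [exact: tame_entry | exact/tameJ/tame_entry]).
Qed.

Lemma moment_swap i j k l : moment i j k l = moment k j i l.
Proof. by congr cint; apply/funext => x; ring. Qed.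

Lemma moment_translate (V : 'M[R[i]]_d) i j k l : unitary V -> moment i j k l =
  cint nu (fun x => (V *m toMx x) i o * conjc ((V *m toMx x) j o)
                 * ((V *m toMx x) k o * conjc ((V *m toMx x) l o))).
Proof.
move=> hV; rewrite /moment -(cint_translate hnu hV (tame_mono i j k l)).
by congr cint; apply/funext => x; rewrite !toMx_translate.
Qed.

Definition phase (s i : 'I_d) : R[i] := if i == s then Complex 0 1 else 1.

Lemma phase_norm s i : phase s i * conjc (phase s i) = 1.
Proof.
rewrite /phase; case: ifP => _; last by rewrite rmorph1 mulr1.
by apply/eqP; rewrite eq_complex /=; apply/andP; split; apply/eqP; ring.
Qed.

(* Invariance under the diagonal unitary with a single entry i (all others 1). *)
Lemma moment_phase s i j k l : moment i j k l =
  phase s i * conjc (phase s j) * (phase s k * conjc (phase s l)) * moment i j k l.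
Proof.
pose V := diag_mx (\row_i phase s i).
have hV : unitary V.
  apply/matrixP => a b; rewrite mul_diag_mx mxE adjmxE !mxE.
  have [->|ab] := eqVneq a b; last by rewrite mulr0n rmorph0 mulr0.
  by rewrite mulr1n phase_norm.
rewrite [LHS](moment_translate _ _ _ _ hV) -cintZ //; last exact: tame_mono.
congr cint; apply/funext => x; rewrite /V !mul_diag_mx !mxE !rmorphM /=.
by ring.
Qed.

(** For unbalanced indices some phase multiplies the moment by the imaginary unit or by its square,
    and a number equal to such a multiple of itself is 0. *)
Lemma moment_eq0 i j k l :
  ~~ ((i == j) && (k == l) || (i == l) && (k == j)) -> moment i j k l = 0.
Proof.
have ci : Complex 0 1 != 1 :> R[i] by rewrite eq_complex /= eq_sym oner_eq0.
have ci2 : Complex 0 1 * Complex 0 1 != 1 :> R[i].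
  rewrite eq_complex /= !mulr0 !mul0r mulr1 sub0r eqNr.
  by rewrite oner_eq0.
suff h s : phase s i * conjc (phase s j) * (phase s k * conjc (phase s l)) != 1 ->
    moment i j k l = 0.
  rewrite negb_or !negb_and.
  (* The phase sits on an index whose factor does not cancel: on [k] when [i] equals [j] or [l], on
     [i] otherwise. *)
  have [E|ij] := eqVneq i j => /=; first subst j.
    move=> /andP[kl _]; apply: (h k).
    by rewrite phase_norm mul1r {2}/phase [l == k]eq_sym (negPf kl) rmorph1 mulr1 /phase eqxx.
  have [il|il] := eqVneq i l => /=.
    move=> kj; apply: (h k); rewrite -il mulrACA [X in _ * X]mulrC mulrACA phase_norm mul1r.
    rewrite {2}/phase [j == k]eq_sym (negPf kj) rmorph1.
    by rewrite mulr1 /phase eqxx.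
  move=> _; apply: (h i).
  rewrite {2}/phase [j == i]eq_sym (negPf ij) rmorph1 mulr1.
  rewrite {3}/phase [l == i]eq_sym (negPf il) rmorph1 mulr1.
  by rewrite /phase eqxx; case: ifP => _ //; rewrite mulr1.
move=> c1; apply/eqP; have := moment_phase s i j k l.
move/eqP; rewrite -{1}[moment i j k l]mul1r -subr_eq0 -mulrBl mulf_eq0 subr_eq0.
by rewrite eq_sym (negPf c1).
Qed.

Section Rotation.
Variables (a b : 'I_d) (V : 'M[R[i]]_d) (c s : R[i]).
Hypotheses (ab : a != b) (hV : unitary V).
Hypotheses (hc : conjc c = c) (hs : conjc s = s).
Hypothesis Va : forall M : 'M[R[i]]_d, (V *m M) a o = c * M a o - s * M b o.

(** Invariance under [V] replaces u_a by c u_a - s u_b. Of the sixteen terms of the expansion only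
    six are balanced: the two pure ones and four equal copies of [moment a a b b]. *)
Lemma moment_rotation : moment a a a a =
  c ^+ 4 * moment a a a a + s ^+ 4 * moment b b b b
  + 4 * c ^+ 2 * s ^+ 2 * moment a a b b.
Proof.
(* Booleans select one of the two summands, so that the fourth-order product becomes a fourfold sum
   over [bool]. *)
pose e (t : bool) := if t then a else b.
pose g (t : bool) := if t then c else - s.
have gJ t : conjc (g t) = g t by case: t => //=; rewrite rmorphN /= hs.
rewrite [LHS](moment_translate _ _ _ _ hV).
have VE x : (V *m toMx x) a o = \sum_t g t * toMx x (e t) o.
  by rewrite Va big_bool /= mulNr.
transitivity (cint nu (fun x => \sum_p \sum_q \sum_r \sum_t
   (g p * g q * g r * g t) * mono (e p) (e q) (e r) (e t) x)).
  congr cint; apply/funext => x; rewrite VE.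
  rewrite rmorph_sum /= big_distrlr /= big_distrl; apply: eq_bigr => p _ /=.
  rewrite big_distrl; apply: eq_bigr => q _ /=.
  rewrite big_distrr; apply: eq_bigr => r _ /=.
  rewrite big_distrr; apply: eq_bigr => t _ /=.
  by rewrite !rmorphM /= !gJ; ring.
have tm p q r t : tame (fun x =>
   (g p * g q * g r * g t) * mono (e p) (e q) (e r) (e t) x).
  by apply: tameM; [exact: tame_cst | exact: tame_mono].
transitivity (\sum_p \sum_q \sum_r \sum_t
   (g p * g q * g r * g t) * moment (e p) (e q) (e r) (e t)).
  rewrite cint_sum //; last by move=> p; do 3 (apply: tame_sum => ?).
  apply: eq_bigr => p _; rewrite cint_sum //; last by move=> ?; do 2 (apply: tame_sum => ?).
  apply: eq_bigr => q _; rewrite cint_sum //; last by move=> ?; apply: tame_sum => ?.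
  apply: eq_bigr => r _; rewrite cint_sum //.
  apply: eq_bigr => t _; rewrite cintZ //; exact: tame_mono.
have m0 p q r t : ~~ ((p == q) && (r == t) || (p == t) && (r == q)) ->
    moment (e p) (e q) (e r) (e t) = 0.
  move=> h; apply: moment_eq0; move: h; have ba := ab; rewrite eq_sym in ba.
  by case: p; case: q; case: r; case: t => //=; rewrite ?eqxx ?(negPf ab) ?(negPf ba).
rewrite !big_bool.
rewrite (m0 true true true false) // (m0 true true false true) //.
rewrite (m0 true false true true) // (m0 true false true false) //.
rewrite (m0 true false false false) // (m0 false true true true) //.
rewrite (m0 false true false true) // (m0 false true false false) //.
rewrite (m0 false false true false) // (m0 false false false true) //=.
have -> : moment b a a b = moment a a b b by congr cint; apply/funext => x; ring.
have -> : moment b b a a = moment a a b b by congr cint; apply/funext => x; ring.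
have -> : moment a b b a = moment a a b b by congr cint; apply/funext => x; ring.
by ring.
Qed.

End Rotation.

(* V is the reflection in the hyperplane orthogonal to x e_a + y e_b, which is a
   unitary with rational entries when x and y are rational. *)
Lemma reflection_rotation (a b : 'I_d) (x y : R) : a != b -> x ^+ 2 + y ^+ 2 != 0 ->
  let c := 1 - 2 * x ^+ 2 / (x ^+ 2 + y ^+ 2) in
  let s := 2 * x * y / (x ^+ 2 + y ^+ 2) in
  exists2 V : 'M[R[i]]_d, unitary V
    & forall M : 'M[R[i]]_d, (V *m M) a o = (c%:C)%C * M a o - (s%:C)%C * M b o.
Proof.
set N := x ^+ 2 + y ^+ 2; move=> ab N0 c s.
pose h : 'cV[R]_d := x *: delta_mx a 0 + y *: delta_mx b 0.
have hT : h^T = x *: delta_mx 0 a + y *: delta_mx 0 b.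
  by rewrite raddfD /= !linearZ /= !trmx_delta.
have hh : h^T *m h = N%:M.
  rewrite hT /h mulmxDl !mulmxDr -!scalemxAl -!scalemxAr.
  rewrite !mul_delta_mx !mul_delta_mx_0 ?(eq_sym b) // !scaler0 addr0 add0r !scalerA -scalerDl.
  by apply/matrixP => i j; rewrite !ord1 !mxE /= mulr1 -!expr2.
pose V0 : 'M[R]_d := 1%:M - (2 / N) *: (h *m h^T).
have V0T : V0^T = V0 by rewrite /V0 linearB linearZ /= trmx1 trmx_mul trmxK.
have V00 : V0 *m V0 = 1%:M.
  rewrite {1}/V0 mulmxBl mul1mx -scalemxAl -mulmxA.
  have -> : h^T *m V0 = - h^T.
    rewrite /V0 mulmxBr mulmx1 -scalemxAr mulmxA hh mul_scalar_mx scalerA.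
    by rewrite divfK // scaler_nat mulr2n opprD addrA subrr add0r.
  by rewrite mulmxN scalerN opprK /V0 subrK.
exists (map_mx (real_complex R) V0).
  rewrite /unitary -[RHS](map_mx1 (real_complex R)) -V00 map_mxM; congr (_ *m _).
  by rewrite adjmx_real V0T.
move=> M; rewrite /V0 map_mxB map_mx1 map_mxZ map_mxM mulmxBl mul1mx.
rewrite -scalemxAl -mulmxA.
have -> : map_mx (real_complex R) h^T *m M
    = (x%:C)%C *: row a M + (y%:C)%C *: row b M.
  rewrite hT map_mxD !map_mxZ !map_delta_mx.
  by rewrite mulmxDl -!scalemxAl -!rowE.
rewrite !mxE big_ord1 !mxE eqxx (negPf ab) /= !mulr1 mulr0 addr0.
rewrite /c /s rmorphB rmorph1 !rmorphM /=.
by ring.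
Qed.

(** The reflection with x = y = 1 has c = 0 and s = 1: it exchanges the two coordinates up to
    sign. *)
Lemma moment_diag_eq (a b : 'I_d) : moment a a a a = moment b b b b.
Proof.
have [->//|ab] := eqVneq a b.
have N0 : (1 : R) ^+ 2 + 1 ^+ 2 != 0 by rewrite expr1n -[_ + _]/(2%:R) pnatr_eq0.
have [V hV hVa] := reflection_rotation ab N0.
have := moment_rotation ab hV (conjc_real _) (conjc_real _) hVa.
have -> : 1 - 2 * (1 : R) ^+ 2 / (1 ^+ 2 + 1 ^+ 2) = 0 by field.
have -> : 2 * (1 : R) * 1 / (1 ^+ 2 + 1 ^+ 2) = 1 by field.
by rewrite rmorph0 rmorph1 => ->; ring.
Qed.

(** The choice x = 1, y = 2 gives c = 3/5 and s = 4/5, both nonzero, so the mixed moment enters the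
    invariance relation. *)
Lemma moment_cross (a b : 'I_d) : a != b -> moment a a a a = 2 * moment a a b b.
Proof.
move=> ab.
have N0 : (1 : R) ^+ 2 + 2 ^+ 2 != 0 by apply: lt0r_neq0; lra.
have [V hV hVa] := reflection_rotation ab N0.
have := moment_rotation ab hV (conjc_real _) (conjc_real _) hVa.
rewrite -(moment_diag_eq a b).
have -> : 1 - 2 * (1 : R) ^+ 2 / (1 ^+ 2 + 2 ^+ 2) = 3 / 5 by field.
have -> : 2 * (1 : R) * 2 / (1 ^+ 2 + 2 ^+ 2) = 4 / 5 by field.
rewrite !rmorphM !fmorphV !rmorph_nat => h.
(* Here 288/625 = 1 - (3/5)^4 - (4/5)^4, and the mixed coefficient 4 (3/5)^2 (4/5)^2 = 576/625 is
   twice as large. *)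
have : (288 / 625 : R[i]) * (moment a a a a - 2 * moment a a b b) = 0.
  transitivity (moment a a a a - ((3 / 5) ^+ 4 * moment a a a a
    + (4 / 5) ^+ 4 * moment a a a a + 4 * (3 / 5) ^+ 2 * (4 / 5) ^+ 2 * moment a a b b)).
    by field.
  by apply/eqP; rewrite subr_eq0; apply/eqP; exact: h.
by move/eqP; rewrite mulf_eq0 mulf_eq0 invr_eq0 !pnatr_eq0 /= subr_eq0 => /eqP.
Qed.

(** Columns of a unitary matrix are unit vectors, and the double sum is the expected square of the
    squared norm of one. *)
Lemma moment_total : \sum_i \sum_k moment i i k k = 1.
Proof.
transitivity (cint nu (fun x => \sum_i \sum_k mono i i k k x)).
  rewrite cint_sum //; last by move=> i; apply: tame_sum => k; exact: tame_mono.
  by apply: eq_bigr => i _; rewrite cint_sum // => k; exact: tame_mono.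
rewrite -[RHS](cint_cst nu 1); apply: eq_cint => //.
- by do 2 (apply: tame_sum => ?); exact: tame_mono.
- exact: tame_cst.
move=> x /unitary_adj hx; have := unitary_sum o o hx; rewrite eqxx.
under eq_bigr do rewrite adjmxE conjcK mulrC.
by move=> h; under eq_bigr do rewrite -big_distrr /= h mulr1.
Qed.

Lemma moment_haar i j k l : moment i j k l =
  (d%:R * (d%:R + 1))^-1 * ((i == j)%:R * (k == l)%:R + (i == l)%:R * (k == j)%:R).
Proof.
pose al := moment o o o o.
(* Pure moments all equal [al] and balanced mixed ones [al / 2]. When the four indices coincide both
   delta products are 1, which restores the factor 2. *)
have key p q r t : moment p q r t =
    al / 2 * ((p == q)%:R * (r == t)%:R + (p == t)%:R * (r == q)%:R).
  have nz : (2 : R[i]) != 0 by rewrite pnatr_eq0.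
  have dg a : moment a a a a = al by exact: moment_diag_eq.
  have cr a b : a != b -> moment a a b b = al / 2.
    by move=> /moment_cross; rewrite dg => ->; field.
  have [|] := boolP ((p == q) && (r == t) || (p == t) && (r == q)); last first.
    move=> h; rewrite (moment_eq0 h) -!natrM !mulnb.
    by move: h; rewrite negb_or => /andP[/negPf -> /negPf ->]; rewrite addr0 mulr0.
  case/orP => /andP[/eqP -> /eqP ->]; rewrite !eqxx !mul1r.
    have [->|qt] := eqVneq q t; first by rewrite dg /=; field.
    by rewrite cr // mul0r addr0 mulr1.
  have [->|qt] := eqVneq t q.
    by rewrite dg /=; field.
  rewrite moment_swap.
  by rewrite cr ?(eq_sym q) // mul0r add0r mulr1.
rewrite key; congr (_ * _).
have nd : (d%:R * (d%:R + 1) : R[i]) != 0.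
  by rewrite natr1 -natrM pnatr_eq0 muln_eq0 orbF -lt0n (leq_ltn_trans _ (ltn_ord o)).
(* Normalization fixes [al]: the delta terms sum to d^2 + d. *)
have := moment_total; under eq_bigr do under eq_bigr do rewrite key !eqxx mulr1.
have -> : \sum_(a < d) \sum_(b < d) al / 2 * (1 + (a == b)%:R * (b == a)%:R)
    = al / 2 * (d%:R * (d%:R + 1)).
  under eq_bigr => a _.
    rewrite -big_distrr big_split /= sumr_const card_ord (bigD1 a) //= eqxx mulr1 big1.
      rewrite addr0; over.
    by move=> b /negPf ->; rewrite mulr0.
  by rewrite sumr_const card_ord -[LHS]mulr_natl /=; ring.
by move=> h; apply: (mulIf nd); rewrite h mulVf.
Qed.

End HaarMoments.

(** * Expansion of linear maps on matrix units *)

Section LinearMaps.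
Variables (R : realType) (d : nat).
Variable Phi : 'M[R[i]]_d -> 'M[R[i]]_d.
Hypothesis hPhi : lin_map Phi.

Lemma lin_map0 : Phi 0 = 0.
Proof.
have := hPhi 1 0 0; rewrite !scale1r addr0 => /eqP.
by rewrite -subr_eq subrr eq_sym => /eqP.
Qed.

Lemma lin_mapD X Y : Phi (X + Y) = Phi X + Phi Y.
Proof. by have := hPhi 1 X Y; rewrite !scale1r. Qed.

Lemma lin_mapZ a X : Phi (a *: X) = a *: Phi X.
Proof. by have := hPhi a X 0; rewrite !addr0 lin_map0 addr0. Qed.

Lemma lin_map_sum (I : Type) (r : seq I) (F : I -> 'M[R[i]]_d) :
  Phi (\sum_(i <- r) F i) = \sum_(i <- r) Phi (F i).
Proof. exact: (big_morph _ lin_mapD lin_map0). Qed.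

Lemma lin_map_delta X : Phi X = \sum_i \sum_j X i j *: Phi (delta_mx i j).
Proof.
rewrite {1}(matrix_sum_delta X) lin_map_sum; apply: eq_bigr => i _.
by rewrite lin_map_sum; apply: eq_bigr => j _; rewrite lin_mapZ.
Qed.

End LinearMaps.

Lemma mxtrace_delta_expand (R : realType) (d : nat)
    (Phi Psi : 'M[R[i]]_d -> 'M[R[i]]_d) (X Y : 'M[R[i]]_d) :
  lin_map Phi -> lin_map Psi -> \tr (adjmx (Phi X) *m Psi Y)
  = \sum_i \sum_j \sum_k \sum_l conjc (X i j) * Y k l
      * \tr (adjmx (Phi (delta_mx i j)) *m Psi (delta_mx k l)).
Proof.
move=> hPhi hPsi.
rewrite (lin_map_delta hPhi X) adjmx_sum mulmx_suml raddf_sum; apply: eq_bigr => i _ /=.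
rewrite adjmx_sum mulmx_suml raddf_sum; apply: eq_bigr => j _ /=.
rewrite (lin_map_delta hPsi Y) mulmx_sumr raddf_sum; apply: eq_bigr => k _ /=.
rewrite mulmx_sumr raddf_sum; apply: eq_bigr => l _ /=.
by rewrite adjmxZ -scalemxAl -scalemxAr !mxtraceZ mulrA.
Qed.

(** * Average fidelity from fourth moments *)

Section AverageFidelity.
Variables (R : realType) (d : nat) (nu : probability (mxcode R d) R).
Hypotheses (hnu : haar nu) (d0 : (0 < d)%N).
Variables (Phi Psi : 'M[R[i]]_d -> 'M[R[i]]_d).
Hypotheses (hPhi : lin_map Phi) (hPsi : lin_map Psi).

Lemma pure_ofE (x : mxcode R d) i j :
  pure_of x i j = toMx x i (Ordinal d0) * conjc (toMx x j (Ordinal d0)).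
Proof.
rewrite /pure_of mxE (bigD1 (Ordinal d0)) //= adjmxE.
have pidE k l : (pid_mx 1 : 'M[R[i]]_d) k l = ((k == l) && (k == Ordinal d0))%:R.
  by rewrite mxE -!val_eqE /= ltnS leqn0.
rewrite big1 ?addr0; last first.
  move=> k /negPf k0; rewrite mxE big1 ?mul0r // => l _.
  by rewrite pidE; have [->|_] := eqVneq l k; rewrite ?k0 mulr0.
rewrite [X in X * _]mxE (bigD1 (Ordinal d0)) //= pidE eqxx mulr1 big1 ?addr0 //.
by move=> k /negPf k0; rewrite pidE k0 andbF mulr0.
Qed.

(** Expanding both maps on matrix units leaves fourth moments. Of the two delta pairings in
    [moment_haar], one reassembles the images of the identity ([S1]) and the other gives the sum
    over matrix units ([S2]). *)
Lemma avg_fid_lin : avg_fid nu Phi Psi = complex.Re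
  ((d%:R * (d%:R + 1))^-1 * (\tr (adjmx (Phi 1%:M) *m Psi 1%:M)
     + \sum_i \sum_j \tr (adjmx (Phi (delta_mx i j)) *m Psi (delta_mx i j)))).
Proof.
pose o := Ordinal d0.
pose h i j k l := \tr (adjmx (Phi (delta_mx i j)) *m Psi (delta_mx k l)).
transitivity (complex.Re (cint nu (fun x =>
    \tr (adjmx (Phi (pure_of x)) *m Psi (pure_of x))))); first by [].
congr complex.Re.
transitivity (cint nu (fun x => \sum_i \sum_j \sum_k \sum_l h i j k l *
   (toMx x j o * conjc (toMx x i o) * (toMx x k o * conjc (toMx x l o))))).
  congr cint; apply/funext => x; rewrite (mxtrace_delta_expand _ _ hPhi hPsi).
  apply: eq_bigr => i _; apply: eq_bigr => j _; apply: eq_bigr => k _; apply: eq_bigr => l _.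
  by rewrite !pure_ofE rmorphM /= conjcK; ring.
transitivity (\sum_i \sum_j \sum_k \sum_l h i j k l * moment nu o j i k l).
  have tm i j k l : tame (fun x => h i j k l *
   (toMx x j o * conjc (toMx x i o) * (toMx x k o * conjc (toMx x l o)))).
    by apply: tameM; [exact: tame_cst | exact: tame_mono].
  rewrite cint_sum //; last by move=> p; do 3 (apply: tame_sum => ?).
  apply: eq_bigr => i _; rewrite cint_sum //; last by move=> ?; do 2 (apply: tame_sum => ?).
  apply: eq_bigr => j _; rewrite cint_sum //; last by move=> ?; apply: tame_sum => ?.
  apply: eq_bigr => k _; rewrite cint_sum //.
  by apply: eq_bigr => l _; rewrite cintZ //; exact: tame_mono.
have S1 : \sum_i \sum_j \sum_k \sum_l h i j k l * ((j == i)%:R * (k == l)%:R)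
    = \tr (adjmx (Phi 1%:M) *m Psi 1%:M).
  rewrite mx1_sum_delta (lin_map_sum hPhi) (lin_map_sum hPsi) adjmx_sum mulmx_suml raddf_sum.
  apply: eq_bigr => i _ /=; rewrite mulmx_sumr raddf_sum.
  rewrite -[RHS](sum_dirac i (fun j => \sum_k h i j k k)); apply: eq_bigr => j _.
  rewrite big_distrr; apply: eq_bigr => k _ /=.
  rewrite -(sum_dirac k (h i j k)) big_distrr; apply: eq_bigr => l _ /=.
  by rewrite [k == l]eq_sym; ring.
have S2 : \sum_i \sum_j \sum_k \sum_l h i j k l * ((j == l)%:R * (k == i)%:R)
    = \sum_i \sum_j h i j i j.
  apply: eq_bigr => i _; apply: eq_bigr => j _.
  rewrite -[RHS](sum_dirac i (fun k => h i j k j)); apply: eq_bigr => k _.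
  rewrite -(sum_dirac j (h i j k)) big_distrr; apply: eq_bigr => l _ /=.
  by rewrite [j == l]eq_sym; ring.
rewrite -S1 -S2 mulrDr !big_distrr -big_split /=; apply: eq_bigr => i _.
rewrite !big_distrr -big_split /=; apply: eq_bigr => j _.
rewrite !big_distrr -big_split /=; apply: eq_bigr => k _.
rewrite !big_distrr -big_split /=; apply: eq_bigr => l _.
by rewrite moment_haar //; ring.
Qed.

End AverageFidelity.

(** * Liouville representation *)

Section HermiticityPreserving.
Variables (R : realType) (d : nat).
Implicit Types Phi Psi : 'M[R[i]]_d -> 'M[R[i]]_d.

(** In a Hermitian basis such maps have real matrix elements, so the real part taken in [liou]
    discards nothing. *)
Definition herm_lin Phi : Prop :=
  lin_map Phi /\ forall X, adjmx (Phi X) = Phi (adjmx X).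

(* Polarization along (1,0), (0,1), (1,1) and (1,i) in each coordinate pair. *)
Lemma real_form_hermitian (I : finType) (M : I -> I -> R[i]) :
  (forall v : I -> R[i],
     complex.Im (\sum_s \sum_t conjc (v s) * M s t * v t) = 0) ->
  forall s t, M t s = conjc (M s t).
Proof.
move=> h s t.
have q x y : complex.Im (conjc x * x * M s s + conjc x * y * M s t
     + conjc y * x * M t s + conjc y * y * M t t) = 0.
  rewrite -(h (fun r => x * (r == s)%:R + y * (r == t)%:R)); congr complex.Im.
  transitivity (\sum_r conjc (x * (r == s)%:R + y * (r == t)%:R)
                 * (x * M r s + y * M r t)).
    under eq_bigr do rewrite rmorphD !rmorphM !rmorph_nat.
    rewrite [RHS](eq_bigr (fun r => (r == s)%:R * (conjc x * (x * M r s + y * M r t))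
       + (r == t)%:R * (conjc y * (x * M r s + y * M r t)))); last first.
      by move=> r _ /=; ring.
    by rewrite big_split /= !sum_dirac; ring.
  apply: eq_bigr => r _.
  rewrite [RHS](eq_bigr (fun z => (z == s)%:R * (conjc (x * (r == s)%:R + y * (r == t)%:R) * x * M r z)
       + (z == t)%:R * (conjc (x * (r == s)%:R + y * (r == t)%:R) * y * M r z))); last first.
    by move=> z _ /=; ring.
  by rewrite big_split /= !sum_dirac; ring.
have := q 1 0; have := q 0 1; have := q 1 1; have := q 1 (Complex 0 1).
case: (M s s) => ? ?; case: (M s t) => ? ?; case: (M t s) => ? ?; case: (M t t) => ? ?.
move=> /= h1 h2 h3 h4; apply/eqP; rewrite eq_complex /=.
by apply/andP; split; apply/eqP; lra.
Qed.

(** The Choi form is nonnegative, hence real, so the Choi matrix is Hermitian. Entrywise this is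
    compatibility with adjoints on matrix units, and linearity extends it. *)
Lemma cp_herm_lin Phi : lin_map Phi -> completely_positive Phi -> herm_lin Phi.
Proof.
move=> hl hcp; split=> // X.
have hM a i b j : Phi (delta_mx b a) j i = conjc (Phi (delta_mx a b) i j).
  pose M (s t : 'I_d * 'I_d) := Phi (delta_mx s.1 t.1) s.2 t.2.
  apply: (real_form_hermitian (M := M) _ (a, i) (b, j)) => v.
  apply: ger0_Im.
  suff -> : \sum_s \sum_t conjc (v s) * M s t * v t =
      \sum_(a < d) \sum_(b < d) \sum_(i < d) \sum_(j < d)
           (v (a, i))^* * Phi (delta_mx a b) i j * v (b, j).
    exact: (hcp (fun a i => v (a, i))).
  under [RHS]eq_bigr do rewrite exchange_big /=.
  rewrite [RHS]pair_bigA /=; apply: eq_bigr => -[s1 s2] _ /=.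
  by rewrite [RHS]pair_bigA /=; apply: eq_bigr => -[t1 t2] _.
apply/matrixP => i j; rewrite adjmxE (lin_map_delta hl X) (lin_map_delta hl (adjmx X)).
rewrite !summxE rmorph_sum /=.
under eq_bigr do rewrite summxE rmorph_sum /=.
under [RHS]eq_bigr do rewrite summxE.
rewrite exchange_big; apply: eq_bigr => a _; apply: eq_bigr => b _ /=.
by rewrite mxE rmorphM /= -hM [RHS]mxE adjmxE.
Qed.

Lemma herm_lin_id : herm_lin id. Proof. by []. Qed.

Lemma herm_lin_comp Phi Psi : herm_lin Phi -> herm_lin Psi -> herm_lin (Phi \o Psi).
Proof.
move=> [l1 h1] [l2 h2]; split=> [a X Y|X] /=; first by rewrite l2 l1.
by rewrite h1 h2.
Qed.

Lemma herm_lin_uchan (U : 'M[R[i]]_d) : herm_lin (uchan U).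
Proof.
split=> [a X Y|X]; rewrite /uchan.
  by rewrite mulmxDr mulmxDl -scalemxAr -scalemxAl.
by rewrite !adjmxM adjmxK mulmxA.
Qed.

Lemma uchan1 (U : 'M[R[i]]_d) : unitary U -> uchan U 1%:M = 1%:M.
Proof. by move=> hU; rewrite /uchan mulmx1. Qed.

Lemma herm_lin_pitr : herm_lin (@pitr R d).
Proof.
split=> [a X Y|X]; rewrite /pitr.
  rewrite mxtraceD mxtraceZ mulrDl scalerDl -mulrA -scalerA scalerBr opprD.
  by rewrite addrACA.
rewrite adjmxB adjmxZ adjmx1 mxtrace_adj.
by rewrite rmorphM /= fmorphV rmorph_nat.
Qed.

Lemma chain_ind (P : ('M[R[i]]_d -> 'M[R[i]]_d) -> Prop) (n m : nat)
    (F : 'I_n -> 'M[R[i]]_d -> 'M[R[i]]_d) (f : {ffun 'I_m -> 'I_n}) :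
  P id -> (forall i Phi, P Phi -> P (F i \o Phi)) -> P (chain F f).
Proof.
move=> P0 PS; rewrite /chain; elim/last_ind: (enum 'I_m) => //= s i.
by rewrite foldl_rcons; exact: PS.
Qed.

End HermiticityPreserving.

(** * Sums over paired indices *)

Section SumUnpair.
Variables (V : nmodType) (m n : nat).

Lemma unpair_index (i : 'I_m) (j : 'I_n) : unpair (mxvec_index i j) = (i, j).
Proof. by rewrite /unpair /mxvec_index cast_ordK enum_rankK. Qed.

Lemma unpair_inj : injective (@unpair m n).
Proof. by move=> s t; case/mxvec_indexP: s => a b; case/mxvec_indexP: t => c e;
  rewrite !unpair_index => -[-> ->]. Qed.

Lemma sum_unpair (F : 'I_m -> 'I_n -> V) :
  \sum_s F (unpair s).1 (unpair s).2 = \sum_i \sum_j F i j.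
Proof.
rewrite pair_bigA (reindex _ (curry_mxvec_bij _ _)) /=.
by apply: eq_bigr => -[i j] _ /=; rewrite unpair_index.
Qed.

End SumUnpair.

(** * Liouville matrices in an orthonormal Hermitian basis *)

Section Liouville.
Variables (R : realType) (d : nat) (Bs : 'I_(d * d) -> 'M[R[i]]_d).
Hypothesis hBs : herm_onb Bs.
Implicit Types (X Y : 'M[R[i]]_d) (Phi Psi : 'M[R[i]]_d -> 'M[R[i]]_d).

Lemma mxtrace_mulE X Y : \tr (adjmx X *m Y) = \sum_i \sum_j conjc (X i j) * Y i j.
Proof.
rewrite exchange_big /mxtrace; apply: eq_bigr => j _; rewrite mxE.
by apply: eq_bigr => i _; rewrite adjmxE.
Qed.

(** Orthonormality says K K^† = 1 for the square matrix [K] whose rows are the flattened basis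
    elements. A one-sided inverse is two-sided, and K^† K = 1 is completeness. *)
Lemma onb_closure i j k l :
  \sum_s conjc (Bs s i j) * Bs s k l = ((i == k) && (j == l))%:R.
Proof.
pose K : 'M[R[i]]_(d * d) := \matrix_(s, t) Bs s (unpair t).1 (unpair t).2.
have /mulmx1C/matrixP/(_ (mxvec_index i j) (mxvec_index k l)) : K *m adjmx K = 1%:M.
  apply/matrixP => s t; rewrite mxE [RHS]mxE eq_sym -(hBs.2 t s) mxtrace_mulE.
  rewrite -(sum_unpair (fun i j => conjc (Bs t i j) * Bs s i j)).
  by apply: eq_bigr => r _; rewrite adjmxE !mxE mulrC.
rewrite !mxE -(inj_eq (@unpair_inj _ _)) !unpair_index -pair_eqE => <-.
by apply: eq_bigr => s _; rewrite adjmxE !mxE !unpair_index.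
Qed.

Lemma onb_expand X : X = \sum_s \tr (adjmx (Bs s) *m X) *: Bs s.
Proof.
apply/matrixP => k l; rewrite summxE.
under eq_bigr do rewrite mxE mxtrace_mulE big_distrl /=.
rewrite exchange_big -(sum_dirac k (fun i => X i l)); apply: eq_bigr => i _ /=.
under eq_bigr do rewrite big_distrl /=.
rewrite exchange_big -(sum_dirac l (X i)) big_distrr; apply: eq_bigr => j _ /=.
under eq_bigr do rewrite mulrAC.
by rewrite -big_distrl /= onb_closure -mulnb natrM mulrA.
Qed.

Lemma onb_parseval X Y : \tr (adjmx X *m Y) =
  \sum_s conjc (\tr (adjmx (Bs s) *m X)) * \tr (adjmx (Bs s) *m Y).
Proof.
rewrite {1}(onb_expand X) adjmx_sum mulmx_suml raddf_sum; apply: eq_bigr => s _ /=.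
by rewrite adjmxZ -scalemxAl mxtraceZ.
Qed.

(** The Hilbert-Schmidt pairing of two superoperators does not depend on the orthonormal basis; by
    completeness the coefficients collapse to deltas. *)
Lemma sum_delta_onb Phi Psi : lin_map Phi -> lin_map Psi ->
  \sum_i \sum_j \tr (adjmx (Phi (delta_mx i j)) *m Psi (delta_mx i j))
  = \sum_s \tr (adjmx (Phi (Bs s)) *m Psi (Bs s)).
Proof.
move=> hPhi hPsi.
pose h i j k l := \tr (adjmx (Phi (delta_mx i j)) *m Psi (delta_mx k l)).
under [RHS]eq_bigr do rewrite (mxtrace_delta_expand _ _ hPhi hPsi).
rewrite [RHS]exchange_big; apply: eq_bigr => i _ /=.
rewrite [RHS]exchange_big; apply: eq_bigr => j _ /=.
rewrite [RHS]exchange_big -[LHS](sum_dirac i (fun k => h i j k j)); apply: eq_bigr => k _ /=.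
rewrite exchange_big -(sum_dirac j (h i j k)) big_distrr; apply: eq_bigr => l _ /=.
rewrite -big_distrl /= onb_closure -mulnb natrM mulrA.
by rewrite [i == k]eq_sym [j == l]eq_sym.
Qed.

(** The trace is its own conjugate, by Hermiticity of the basis, compatibility of [Phi] with
    adjoints, and cyclicity. *)
Lemma liouE Phi j k : herm_lin Phi ->
  ((liou Bs Phi j k)%:C)%C = \tr (adjmx (Bs j) *m Phi (Bs k)).
Proof.
move=> [_ hP]; rewrite mxE -real_conjc // -mxtrace_adj adjmxM adjmxK hP.
by rewrite !hBs.1 mxtrace_mulC.
Qed.

Lemma liou_comp Phi Psi : herm_lin Phi -> herm_lin Psi ->
  liou Bs (Phi \o Psi) = liou Bs Phi *m liou Bs Psi.
Proof.
move=> h1 h2; apply/matrixP => j k; apply: (@complexI R).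
rewrite liouE; last exact: herm_lin_comp.
rewrite mxE rmorph_sum /= {1}(onb_expand (Psi (Bs k))) (lin_map_sum h1.1) mulmx_sumr raddf_sum.
apply: eq_bigr => l _ /=.
by rewrite (lin_mapZ h1.1) -scalemxAr mxtraceZ rmorphM /= !liouE // mulrC.
Qed.

Lemma liou_id : liou Bs id = 1%:M.
Proof.
apply/matrixP => j k; apply: (@complexI R).
by rewrite liouE ?hBs.2 ?mxE ?rmorph_nat.
Qed.

Lemma liou_gram Phi Psi : herm_lin Phi -> herm_lin Psi ->
  \sum_s \tr (adjmx (Phi (Bs s)) *m Psi (Bs s))
  = ((\tr ((liou Bs Phi)^T *m liou Bs Psi))%:C)%C.
Proof.
move=> h1 h2; rewrite [in RHS]/mxtrace rmorph_sum; apply: eq_bigr => s _ /=.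
rewrite mxE rmorph_sum onb_parseval; apply: eq_bigr => t _ /=.
by rewrite rmorphM /= mxE -!liouE // conjc_real.
Qed.

Lemma liou_uchan_adj (U : 'M[R[i]]_d) : liou Bs (uchan (adjmx U)) = (liou Bs (uchan U))^T.
Proof.
apply/matrixP => j k; apply: (@complexI R).
rewrite [in RHS]mxE !liouE; try exact: herm_lin_uchan.
by rewrite /uchan adjmxK !hBs.1 mxtrace_mulC -!mulmxA mxtrace_mulC !mulmxA.
Qed.

(** The coordinates of the identity matrix and, as a row, the trace functional: a right fixed vector
    of unital maps and a left one of trace-preserving maps. *)
Definition traces : 'cV[R]_(d * d) := \col_k complex.Re (\tr (Bs k)).

Lemma tracesE k : ((traces k 0)%:C)%C = \tr (Bs k).
Proof. by rewrite mxE -real_conjc // -mxtrace_adj hBs.1. Qed.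

Lemma traces_dot : traces^T *m traces = d%:R%:M.
Proof.
apply/matrixP => i j; rewrite !ord1; apply: (@complexI R).
rewrite !mxE rmorph_nat rmorph_sum -mxtrace1.
rewrite -[in RHS](mulmx1 1%:M) -{1}(adjmx1 R d) onb_parseval; apply: eq_bigr => s _ /=.
by rewrite rmorphM /= mxE !tracesE mulmx1 mxtrace_adj conjcK -mxtrace_adj hBs.1.
Qed.

Lemma liou_pitr : liou Bs (@pitr R d) = 1%:M - (d%:R)^-1 *: (traces *m traces^T).
Proof.
apply/matrixP => j k; apply: (@complexI R); rewrite liouE; last exact: herm_lin_pitr.
rewrite !mxE big_ord1 [traces^T 0 k]mxE rmorphB !rmorphM fmorphV !rmorph_nat /= !tracesE.
rewrite /pitr mulmxBr raddfB /= hBs.2 -scalemxAr mulmx1 mxtraceZ hBs.1.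
by congr (_ - _); ring.
Qed.

Lemma liou_unital Psi : herm_lin Psi -> Psi 1%:M = 1%:M ->
  liou Bs Psi *m traces = traces.
Proof.
move=> h1 h2; apply/matrixP => j k; rewrite !ord1; apply: (@complexI R).
rewrite mxE rmorph_sum tracesE -[in RHS]hBs.1 -[in RHS](mulmx1 (adjmx _)) -h2.
rewrite [in RHS](onb_expand 1%:M) (lin_map_sum h1.1) mulmx_sumr raddf_sum.
apply: eq_bigr => s _ /=.
by rewrite (lin_mapZ h1.1) -scalemxAr mxtraceZ rmorphM /= liouE // tracesE mulmx1 !hBs.1 mulrC.
Qed.

Lemma liou_tp Phi : herm_lin Phi -> trace_preserving Phi ->
  traces^T *m liou Bs Phi = traces^T.
Proof.
move=> h1 h2; apply/matrixP => j k; rewrite !ord1; apply: (@complexI R).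
rewrite mxE [X in _ = (X%:C)%C]mxE rmorph_sum tracesE -h2.
rewrite -[Phi _](mul1mx) -(adjmx1 R d) onb_parseval.
apply: eq_bigr => s _ /=.
by rewrite rmorphM /= mxE tracesE liouE // mulmx1 mxtrace_adj conjcK.
Qed.

Lemma liou_chain (n m : nat) (F : 'I_n -> 'M[R[i]]_d -> 'M[R[i]]_d)
    (f : {ffun 'I_m -> 'I_n}) : (forall i, herm_lin (F i)) ->
  herm_lin (chain F f) /\ liou Bs (chain F f) = prodL (fun i => liou Bs (F i)) f.
Proof.
move=> hF; rewrite /chain /prodL; elim/last_ind: (enum 'I_m) => [|s i [h1 h2]] /=.
  by split; [exact: herm_lin_id | exact: liou_id].
rewrite !foldl_rcons; split; first exact: herm_lin_comp.
by rewrite liou_comp // h2.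
Qed.

Lemma avg_fid_liou (nu : probability (mxcode R d) R) Phi Psi :
  haar nu -> (0 < d)%N -> herm_lin Phi -> trace_preserving Phi ->
  herm_lin Psi -> Psi 1%:M = 1%:M ->
  avg_fid nu Phi Psi = (d%:R * (d%:R + 1))^-1
    * (d%:R + \tr ((liou Bs Phi)^T *m liou Bs Psi)).
Proof.
move=> hnu d0 h1 h2 h3 h4.
rewrite (avg_fid_lin hnu d0 h1.1 h3.1) sum_delta_onb ?h1.1 ?h3.1 // ?liou_gram //; last 2 first.
- exact: h1.1.
- exact: h3.1.
rewrite h4 mulmx1 mxtrace_adj h2 mxtrace1 rmorph_nat.
by rewrite -!(rmorph_nat (real_complex R)) -(rmorph1 (real_complex R)) -!rmorphD -!rmorphM -fmorphV -rmorphM.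
Qed.

End Liouville.

(** * Kronecker products and deflation *)

Section KroneckerVec.
Variables (T : comPzRingType) (k : nat).
Implicit Types A B X Y : 'M[T]_k.

Lemma kron_mul A B X Y : kron A B *m kron X Y = kron (A *m X) (B *m Y).
Proof.
apply/matrixP => a b; rewrite !mxE big_distrlr /=.
rewrite -(sum_unpair (fun s t => A (unpair a).1 s * X s (unpair b).1
   * (B (unpair a).2 t * Y t (unpair b).2))).
by apply: eq_bigr => s _; rewrite !mxE mulrACA.
Qed.

Lemma kron1 : kron 1%:M 1%:M = 1%:M :> 'M[T]_(k * k).
Proof.
apply/matrixP => a b; rewrite !mxE -(inj_eq (@unpair_inj _ _)) -natrM mulnb.
by case: (unpair a) (unpair b) => ? ? [? ?].
Qed.

Lemma trmx_kron A B : (kron A B)^T = kron A^T B^T.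
Proof. by apply/matrixP => a b; rewrite !mxE. Qed.

(** Column stacking keeps the column index in the first tensor factor, so [X] acts on columns and
    reappears transposed on the right. *)
Lemma kron_vecm X Y A : kron X Y *m vecm A = vecm (Y *m A *m X^T).
Proof.
apply/matrixP => a b; rewrite !mxE.
rewrite [RHS](eq_bigr (fun i => \sum_j X (unpair a).1 i * Y (unpair a).2 j * A j i)).
  rewrite -(sum_unpair (fun i j => X (unpair a).1 i * Y (unpair a).2 j * A j i)).
  by apply: eq_bigr => s _; rewrite !mxE.
move=> i _; rewrite !mxE big_distrl; apply: eq_bigr => j _ /=.
by rewrite -[RHS]mulrA [RHS]mulrC.
Qed.

Lemma vecm_dot A B : ((vecm A)^T *m vecm B) 0 0 = \tr (A^T *m B).
Proof.
rewrite mxE /mxtrace; under [RHS]eq_bigr do rewrite mxE.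
rewrite -(sum_unpair (fun i j => A^T i j * B j i)).
by apply: eq_bigr => s _; rewrite !mxE.
Qed.

Lemma kron_form X Y A : ((vecm A)^T *m kron X Y *m vecm A) 0 0
  = \tr (Y^T *m (A *m X *m A^T)).
Proof.
rewrite -mulmxA kron_vecm vecm_dot -mxtrace_tr !trmx_mul !trmxK.
by rewrite mxtrace_mulC !mulmxA mxtrace_mulC !mulmxA.
Qed.

Lemma vecm_inj : injective (@vecm T k).
Proof.
move=> A B /matrixP AB; apply/matrixP => i j.
by have := AB (mxvec_index j i) 0; rewrite !mxE unpair_index.
Qed.

Lemma vecmZ (c : T) A : vecm (c *: A) = c *: vecm A.
Proof. by apply/matrixP => a b; rewrite !mxE. Qed.

Lemma vecm_sum (I : Type) (r : seq I) (F : I -> 'M[T]_k) :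
  vecm (\sum_(i <- r) F i) = \sum_(i <- r) vecm (F i).
Proof.
apply/matrixP => a b; rewrite !mxE !summxE.
by apply: eq_bigr => i _; rewrite mxE.
Qed.

Lemma prodL_kron (n m : nat) (X Y : 'I_n -> 'M[T]_k) (f : {ffun 'I_m -> 'I_n}) :
  prodL (fun i => kron (X i) (Y i)) f = kron (prodL X f) (prodL Y f).
Proof.
rewrite /prodL; elim/last_ind: (enum 'I_m) => [|s i IH] /=; first by rewrite kron1.
by rewrite !foldl_rcons IH kron_mul.
Qed.

End KroneckerVec.

(** * Matrix powers as sums over gate sequences *)

Section MatrixPowers.
Variables (T : comPzRingType) (k : nat).
Implicit Types M : 'M[T]_k.

Lemma mxpow_exp M m : mxpow M m = M ^+ m.
Proof. by elim: m => [|m IH] //; rewrite exprS /mxpow /= -/(mxpow M m) IH. Qed.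

Lemma mxpowS M m : mxpow M m.+1 = M *m mxpow M m.
Proof. by []. Qed.

Lemma mxpowSr M m : mxpow M m.+1 = mxpow M m *m M.
Proof. by rewrite !mxpow_exp exprSr. Qed.

Lemma trmx_mxpow M m : (mxpow M m)^T = mxpow M^T m.
Proof.
elim: m => [|m IH]; first by rewrite trmx1.
by rewrite mxpowS mxpowSr trmx_mul IH.
Qed.

Lemma mxpowZ (c : T) M m : mxpow (c *: M) m = c ^+ m *: mxpow M m.
Proof.
elim: m => [|m IH]; first by rewrite expr0 scale1r.
by rewrite !mxpowS IH -scalemxAl -scalemxAr scalerA exprS.
Qed.

Lemma sum_prodL (n m : nat) (K : 'I_n -> 'M[T]_k) :
  \sum_(f : {ffun 'I_m -> 'I_n}) prodL K f = mxpow (\sum_i K i) m.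
Proof.
(* [prodL] puts later factors on the left while [\prod] puts them on the right; transposition
   reverses the order, so the distributivity of [\prod] over sums applies. *)
have prodLE (f : {ffun 'I_m -> 'I_n}) : prodL K f = (\prod_i (K (f i))^T)^T.
  have -> : \prod_i (K (f i))^T = \prod_(i <- enum 'I_m) (K (f i))^T.
    by rewrite enumT [index_enum _]unlock.
  rewrite /prodL; elim/last_ind: (enum 'I_m) => [|s i IH] /=.
    by rewrite big_nil trmx1.
  by rewrite foldl_rcons big_rcons /= trmx_mul trmxK IH.
under eq_bigr do rewrite prodLE.
rewrite -raddf_sum /= -(bigA_distr_bigA (fun _ j => (K j)^T)) prodr_const card_ord.
by rewrite -mxpow_exp trmx_mxpow raddf_sum /=; congr mxpow; apply: eq_bigr => i _; exact: trmxK.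
Qed.

End MatrixPowers.

(** * Powers of the twirl as circuit averages *)

Section Twirl.
Variables (R : realType) (k n : nat) (X Y : 'I_n -> 'M[R]_k).
Let T := n%:R^-1 *: \sum_(i < n) kron (X i) (Y i).

Lemma twirl_power m :
  (n%:R ^+ m)^-1 *: \sum_(f : {ffun 'I_m -> 'I_n}) kron (prodL X f) (prodL Y f)
  = mxpow T m.
Proof.
rewrite /T mxpowZ -sum_prodL exprVn; congr (_ *: _).
by apply: eq_bigr => f _; rewrite prodL_kron.
Qed.

(** With [A] equal to Pi this is the average whose rescaled limit is [Binf]; [twirl_left] does the
    same for [Ainf] with the transposed twirl. *)
Lemma twirl_right (A : 'M[R]_k) m :
  vecm (Emx (fun f : {ffun 'I_m -> 'I_n} => prodL Y f *m A *m (prodL X f)^T))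
  = mxpow T m *m vecm A.
Proof.
rewrite /Emx vecmZ vecm_sum -twirl_power -scalemxAl mulmx_suml; congr (_ *: _).
by apply: eq_bigr => f _; rewrite kron_vecm.
Qed.

Lemma twirl_left (A : 'M[R]_k) m :
  vecm (Emx (fun f : {ffun 'I_m -> 'I_n} => (prodL X f)^T *m A *m prodL Y f))^T
  = mxpow T^T m *m vecm A^T.
Proof.
rewrite -trmx_mxpow -twirl_power /Emx !linearZ /= vecmZ -scalemxAl; congr (_ *: _).
rewrite !raddf_sum /= vecm_sum mulmx_suml; apply: eq_bigr => f _.
by rewrite trmx_kron kron_vecm !trmx_mul !trmxK mulmxA.
Qed.

End Twirl.

(** * Rank-one deflation of an eigenpair *)

Section Deflation.
Variables (R : realType) (K : nat) (T : 'M[R]_K) (p : R).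

(** Shifting the sequence by one applies p^-1 T and keeps the limit, so y = p^-1 T y. *)
Lemma power_limit_eigen (x y : 'cV[R]_K) : p != 0 ->
  (forall k, (fun m : nat => (p ^+ m)^-1 * (mxpow T m *m x) k 0) @ \oo --> y k 0) ->
  T *m y = p *: y.
Proof.
move=> p0 h; apply/matrixP => k j; rewrite !ord1 [RHS]mxE.
apply: (mulfI (invr_neq0 p0)); rewrite mulKf //.
have h1 := h k; rewrite -cvg_shiftS in h1.
apply: (norm_cvg_unique _ h1).
rewrite mxE.
have E m : (p ^+ m.+1)^-1 * (mxpow T m.+1 *m x) k 0
   = p^-1 * \sum_l T k l * ((p ^+ m)^-1 * (mxpow T m *m x) l 0).
  rewrite mxpowS -mulmxA mxE exprS invfM -mulrA; congr (_ * _).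
  by rewrite big_distrr; apply: eq_bigr => l _ /=; rewrite mulrCA.
have -> : [sequence (p ^+ n.+1)^-1 * (mxpow T n.+1 *m x) k 0]_n
    = (fun m => p^-1 * \sum_l T k l * ((p ^+ m)^-1 * (mxpow T m *m x) l 0)).
  by apply/funext => m; exact: E.
apply: cvgMl_tmp; apply: (@cvg_big _ _ +%R); first exact: add_continuous.
by move=> l _; apply: cvgMl_tmp; exact: h.
Qed.

Variables (x y : 'cV[R]_K) (q : R).
Hypotheses (q0 : q != 0) (xy : (y^T *m x) 0 0 = q).
Hypotheses (Tx : T *m x = p *: x) (Ty : y^T *m T = p *: y^T).
Let Delta := T - (p / q) *: (x *m y^T).

Let dot_scalar : y^T *m x = q%:M.
Proof. by apply/matrixP => i j; rewrite !ord1 xy mxE. Qed.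

Lemma deflate_right m : (0 < m)%N -> mxpow Delta m *m x = 0.
Proof.
case: m => // m _; rewrite mxpowSr -mulmxA /Delta mulmxBl Tx -scalemxAl -mulmxA.
by rewrite dot_scalar mul_mx_scalar scalerA divfK // subrr mulmx0.
Qed.

Lemma deflate_left m : (0 < m)%N -> y^T *m mxpow Delta m = 0.
Proof.
case: m => // m _; rewrite mxpowS mulmxA /Delta mulmxBr Ty -scalemxAr mulmxA.
by rewrite dot_scalar mul_scalar_mx scalerA divfK // subrr mul0mx.
Qed.

Lemma deflate_power m : (0 < m)%N ->
  mxpow T m = mxpow Delta m + (p ^+ m / q) *: (x *m y^T).
Proof.
(* The induction starts at 1. At 0 both powers are the identity, and the rank-one term, nonzero
   because [q] is, would remain. *)
elim: m => // -[_ _|m IH _].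
  by rewrite /mxpow /= !mulmx1 /Delta expr1 subrK.
rewrite mxpowS IH // mulmxDr; congr (_ + _).
  by rewrite [in RHS]mxpowS {2}/Delta mulmxBl -scalemxAl -mulmxA deflate_left // mulmx0 scaler0 subr0.
by rewrite -scalemxAr mulmxA Tx -scalemxAl scalerA [p ^+ m.+2]exprS mulrC mulrA.
Qed.

(** The rank-one part is evaluated on [z] itself. Around the power of [Delta] the two decompositions
    of [z] are substituted, and the components along [y] and [x] are annihilated. *)
Lemma deflate_form (z w v : 'cV[R]_K) (a b s t : R) m : (0 < m)%N ->
  z^T = a *: y^T + s *: w^T -> z = b *: x + t *: v ->
  (z^T *m mxpow T m *m z) 0 0 =
    p ^+ m / q * (z^T *m x) 0 0 * (y^T *m z) 0 0
    + s * t * (w^T *m mxpow Delta m *m v) 0 0.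
Proof.
move=> m0 zl zr; rewrite deflate_power // mulmxDr mulmxDl [LHS]mxE addrC; congr (_ + _).
  rewrite -scalemxAr -scalemxAl mxE -[RHS]mulrA; congr (_ * _).
  have -> : z^T *m (x *m y^T) *m z = (z^T *m x) *m (y^T *m z) by rewrite !mulmxA.
  by rewrite [LHS]mxE big_ord1.
rewrite zl mulmxDl -!scalemxAl deflate_left // scaler0 add0r.
rewrite {}zr mulmxDr -!scalemxAr -!scalemxAl -!mulmxA deflate_right // mulmx0 !scaler0 add0r.
by rewrite mxE mxE mulmxA mulrCA mulrA.
Qed.

End Deflation.

(** * Circuit fidelity *)

(** The projection commutes with each gate, so its copies move to one end and merge by
    idempotence. *)
Lemma prodL_proj (T : comPzRingType) (k n m : nat) (P : 'M[T]_k) (G : 'I_n -> 'M[T]_k)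
    (f : {ffun 'I_m -> 'I_n}) :
  P *m P = P -> (forall i, G i *m P = P *m G i) ->
  P *m prodL (fun i => G i *m P) f = prodL G f *m P.
Proof.
move=> PP GP; rewrite /prodL; elim/last_ind: (enum 'I_m) => [|s i IH] /=.
  by rewrite mul1mx mulmx1.
by rewrite !foldl_rcons -[RHS]mulmxA -IH [G (f i) *m P]GP !mulmxA PP GP.
Qed.

Section CircuitFidelity.
Variables (R : realType) (d : nat) (Bs : 'I_(d * d) -> 'M[R[i]]_d).
Hypotheses (hBs : herm_onb Bs) (hd : (1 < d)%N).
Local Notation Pi := (liou Bs (@pitr R d)).
Local Notation e := (traces Bs).

Let dn0 : d%:R != 0 :> R. Proof. by rewrite pnatr_eq0 -lt0n ltnW. Qed.

Lemma liou_pitr_sym : Pi^T = Pi.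
Proof. by rewrite liou_pitr // linearB linearZ /= trmx1 trmx_mul trmxK. Qed.

Lemma liou_mul_pitr (W : 'M[R]_(d * d)) : W *m e = e ->
  W *m Pi = W - (d%:R)^-1 *: (e *m e^T).
Proof. by move=> h; rewrite liou_pitr // mulmxBr mulmx1 -scalemxAr mulmxA h. Qed.

Lemma pitr_mul_liou (W : 'M[R]_(d * d)) : e^T *m W = e^T ->
  Pi *m W = W - (d%:R)^-1 *: (e *m e^T).
Proof.
by move=> h; rewrite liou_pitr // mulmxBl mul1mx -scalemxAl -mulmxA h.
Qed.

Lemma liou_pitr_idem : Pi *m Pi = Pi.
Proof.
rewrite {2}liou_pitr // mulmxBr mulmx1 -scalemxAr mulmxA.
have -> : Pi *m e = 0.
  rewrite liou_pitr // mulmxBl mul1mx -scalemxAl -mulmxA traces_dot // mul_mx_scalar.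
  by rewrite scalerA mulVf // scale1r subrr.
by rewrite mul0mx scaler0 subr0.
Qed.

(** For a symmetric idempotent the squared Frobenius norm is the trace, here d^2 - 1. *)
Lemma normF_pitr : normF Pi ^+ 2 = d%:R ^+ 2 - 1.
Proof.
have ipE : ipF Pi Pi = d%:R ^+ 2 - 1.
  rewrite /ipF liou_pitr_sym liou_pitr_idem liou_pitr // raddfB /= mxtraceZ.
  rewrite mxtrace_mulC traces_dot // mxtrace1 mxtrace_scalar mulr1n mulVf //.
  by rewrite natrM expr2.
rewrite /normF sqr_sqrtr ipE // subr_ge0 -natrX ler1n expn_gt0.
by rewrite (ltnW hd).
Qed.

Lemma uchan_tp (V : 'M[R[i]]_d) : unitary V -> trace_preserving (uchan V).
Proof.
move=> hV X; rewrite /uchan mxtrace_mulC mulmxA.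
by rewrite (mulmx1C hV) mul1mx.
Qed.

Lemma liou_uchan_traces (V : 'M[R[i]]_d) : unitary V ->
  liou Bs (uchan V) *m e = e /\ e^T *m liou Bs (uchan V) = e^T.
Proof.
move=> hV; split; first by apply: liou_unital => //; [exact: herm_lin_uchan | exact: uchan1].
by apply: liou_tp => //; [exact: herm_lin_uchan | exact: uchan_tp].
Qed.

Lemma liou_uchan_comm (V : 'M[R[i]]_d) : unitary V ->
  liou Bs (uchan V) *m Pi = Pi *m liou Bs (uchan V).
Proof.
by move=> /liou_uchan_traces[h1 h2]; rewrite liou_mul_pitr // pitr_mul_liou.
Qed.

(* The identity component contributes exactly 1 because W is unital and Y is
   trace preserving. *)
Lemma trace_pitr_split (Y W : 'M[R]_(d * d)) : e^T *m Y = e^T -> W *m e = e ->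
  \tr (Y^T *m W) = \tr (Y^T *m (W *m Pi)) + 1.
Proof.
move=> hY hW; rewrite liou_mul_pitr // mulmxBr raddfB /= -scalemxAr mxtraceZ mulmxA.
have -> : Y^T *m e = e by rewrite -[RHS]trmxK -hY trmx_mul trmxK.
by rewrite [\tr (e *m e^T)]mxtrace_mulC traces_dot // mxtrace_scalar mulr1n mulVf // subrK.
Qed.

Variables (nu : probability (mxcode R d) R) (n : nat).
Variables (Ug : 'I_n -> 'M[R[i]]_d) (Gt : 'I_n -> 'M[R[i]]_d -> 'M[R[i]]_d).
Variable U : 'M[R[i]]_d.
Hypotheses (hnu : haar nu) (hn : (0 < n)%N) (hUg : forall i, unitary (Ug i)).
Hypotheses (hGt : forall i, CPTP (Gt i)) (hU : unitary U).
Let X i := liou Bs (uchan (Ug i)) *m Pi.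
Let Y i := liou Bs (Gt i).
Let T := n%:R^-1 *: \sum_(i < n) kron (X i) (Y i).
Let Z := liou Bs (uchan U) *m Pi.

(** Splitting off the identity component gives d + 1 plus a traceless part, and (d + 1) / (d (d +
    1)) = 1/d. The traceless part is the Kronecker form because Pi commutes with all the unitary
    channels. *)
Lemma avg_fid_circuit m (f : {ffun 'I_m -> 'I_n}) :
  avg_fid nu (chain Gt f)
     (uchan U \o chain (fun i => uchan (Ug i)) f \o uchan (adjmx U))
  = d%:R^-1 + (d%:R * (d%:R + 1))^-1
     * ((vecm Z)^T *m kron (prodL X f) (prodL Y f) *m vecm Z) 0 0.
Proof.
have hGl i : herm_lin (Gt i) by case: (hGt i) => h1 h2 _; exact: cp_herm_lin.
have [cG cGE] := liou_chain hBs f hGl.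
have [cU cUE] := liou_chain hBs f (fun i => herm_lin_uchan (Ug i)).
have tpG : trace_preserving (chain Gt f).
  by apply: chain_ind => // i Phi hP A /=; case: (hGt i) => _ _ ->.
have unU : chain (fun i => uchan (Ug i)) f 1%:M = 1%:M.
  by apply: (chain_ind (P := fun Phi => Phi 1%:M = 1%:M)) => // i Phi /= ->; exact: uchan1.
have hUa := unitary_adj hU.
have hl : herm_lin (uchan U \o chain (fun i => uchan (Ug i)) f \o uchan (adjmx U)).
  exact: (herm_lin_comp (herm_lin_comp (herm_lin_uchan U) cU) (herm_lin_uchan _)).
have un1 : (uchan U \o chain (fun i => uchan (Ug i)) f \o uchan (adjmx U)) 1%:M = 1%:M.
  by rewrite /= uchan1 // unU uchan1.
rewrite (avg_fid_liou hBs hnu (ltnW hd) cG tpG hl un1).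
rewrite (trace_pitr_split (liou_tp hBs cG tpG) (liou_unital hBs hl un1)).
have -> : ((vecm Z)^T *m kron (prodL X f) (prodL Y f) *m vecm Z) 0 0
   = \tr ((liou Bs (chain Gt f))^T *m
      (liou Bs (uchan U \o chain (fun i => uchan (Ug i)) f \o uchan (adjmx U)) *m Pi)).
  rewrite kron_form cGE; congr (\tr (_ *m _)).
  rewrite (liou_comp hBs (herm_lin_comp (herm_lin_uchan U) cU) (herm_lin_uchan _)).
  rewrite (liou_comp hBs (herm_lin_uchan U) cU) cUE liou_uchan_adj //.
  have UP : (liou Bs (uchan U))^T *m Pi = Pi *m (liou Bs (uchan U))^T.
    by rewrite -{1}liou_pitr_sym -trmx_mul -liou_uchan_comm // trmx_mul liou_pitr_sym.
  (* Pi is moved through the transpose of U to stand next to the ideal circuit, where [prodL_proj]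
     absorbs the projections placed between gates. *)
  rewrite -[RHS]mulmxA UP /Z trmx_mul liou_pitr_sym -!mulmxA; congr (_ *m _).
  rewrite mulmxA (prodL_proj _ liou_pitr_idem (fun i => liou_uchan_comm (hUg i))).
  by rewrite -!mulmxA; congr (_ *m _); rewrite mulmxA liou_pitr_idem.
have d1 : (d%:R + 1 : R) != 0 by rewrite natr1 pnatr_eq0.
by field; rewrite dn0 d1.
Qed.

Lemma circuit_fid_twirl m : circuit_fid nu Gt Ug U m =
  d%:R^-1 + (d%:R * (d%:R + 1))^-1 * ((vecm Z)^T *m mxpow T m *m vecm Z) 0 0.
Proof.
rewrite /circuit_fid; under eq_bigr do rewrite avg_fid_circuit.
rewrite big_split /= sumr_const card_ffun !card_ord mulrDr -[d%:R^-1 *+ _]mulr_natl natrX mulrA.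
rewrite mulVf ?mul1r ?expf_neq0 ?pnatr_eq0 -?lt0n //; congr (_ + _).
rewrite -big_distrr /= mulrCA; congr (_ * _).
rewrite -twirl_power -scalemxAr -scalemxAl [RHS]mxE; congr (_ * _).
by rewrite mulmx_sumr mulmx_suml summxE.
Qed.

End CircuitFidelity.

(** Each [X i] absorbs [P], so the range of the transposed twirl lies in that of P (x) 1, and so
    does any eigenvector with nonzero eigenvalue. For [Ainf] this lets Pi be dropped from inner
    products. *)
Lemma twirl_left_invariant (R : realType) (k n : nat) (P : 'M[R]_k) (p : R)
    (X Y : 'I_n -> 'M[R]_k) (A : 'M[R]_k) :
  p != 0 -> P^T = P -> (forall i, X i *m P = X i) ->
  (n%:R^-1 *: \sum_(i < n) kron (X i) (Y i))^T *m vecm A^T = p *: vecm A^T ->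
  P *m A = A.
Proof.
move=> p0 PT XP; set T := _ *: _ => TA.
have PTT : kron P 1%:M *m T^T = T^T.
  rewrite /T !linearZ /=; congr (_ *: _).
  rewrite raddf_sum /= mulmx_sumr; apply: eq_bigr => i _.
  by rewrite trmx_kron kron_mul mul1mx -{1}PT -trmx_mul XP.
apply: trmx_inj; rewrite trmx_mul PT; apply: vecm_inj.
have := kron_vecm P 1%:M A^T; rewrite mul1mx PT => <-.
by apply: (scalerI p0); rewrite -TA scalemxAr -TA mulmxA PTT.
Qed.

(** * The decay formula for the circuit fidelity *)

Theorem theorem1
  (R : realType) (d : nat) (hd : (1 < d)%N)
  (* normalised Haar measure on U(d) (defines uniform pure states and 2-designs) *)
  (nu : probability (mxcode R d) R) (hnu : haar nu)
  (* the finite group G of unitary channels, G = {uchan (Ug i) | i < n} *)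
  (n : nat) (Ug : 'I_n -> 'M[R[i]]_d)
  (hn : (0 < n)%N)
  (hUg : forall i, unitary (Ug i))
  (hinj : forall i j, (forall X, uchan (Ug i) X = uchan (Ug j) X) -> i = j)
  (hgrp : forall i j, exists k, forall X,
            uchan (Ug k) X = uchan (Ug i) (uchan (Ug j) X))
  (h2d : unitary_2design nu Ug)
  (* noisy (gate-dependent) implementation *)
  (Gt : 'I_n -> 'M[R[i]]_d -> 'M[R[i]]_d) (hGt : forall i, CPTP (Gt i))
  (* orthonormal Hermitian operator basis defining Liouville matrices *)
  (Bs : 'I_(d * d) -> 'M[R[i]]_d) (hBs : herm_onb Bs)
  (* p : largest eigenvalue of T *)
  (p : R)
  (hp : eigenvalue (n%:R^-1 *: \sum_(i < n)
          kron (liou Bs (uchan (Ug i)) *m liou Bs (@pitr R d)) (liou Bs (Gt i))) p)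
  (hpmax : forall lam : R[i],
     eigenvalue (map_mx (real_complex R) (n%:R^-1 *: \sum_(i < n)
          kron (liou Bs (uchan (Ug i)) *m liou Bs (@pitr R d)) (liou Bs (Gt i)))) lam ->
     `|lam| <= (p%:C)%C)
  (* A_inf and B_inf as limits *)
  (Ainf Binf : 'M[R]_(d * d))
  (hA : forall j k,
     (fun m : nat =>
        (p ^+ m)^-1 * (Emx (fun f : {ffun 'I_m -> 'I_n} =>
           (prodL (fun i => liou Bs (uchan (Ug i)) *m liou Bs (@pitr R d)) f)^T
           *m liou Bs (@pitr R d) *m prodL (fun i => liou Bs (Gt i)) f)) j k)
     @ \oo --> Ainf j k)
  (hB : forall j k,
     (fun m : nat =>
        (p ^+ m)^-1 * (Emx (fun f : {ffun 'I_m -> 'I_n} =>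
           prodL (fun i => liou Bs (Gt i)) f *m liou Bs (@pitr R d)
           *m (prodL (fun i => liou Bs (uchan (Ug i)) *m liou Bs (@pitr R d)) f)^T)) j k)
     @ \oo --> Binf j k)
  (hAB : ipF Ainf^T Binf != 0)
  (* the unitary channel U *)
  (U : 'M[R[i]]_d) (hU : unitary U)
  (* unit vectors w(U), v(U) *)
  (w v : 'cV[R]_((d * d) * (d * d)))
  (hw1 : (w^T *m w) 0 0 = 1) (hv1 : (v^T *m v) 0 0 = 1) :
  let Pi := liou Bs (@pitr R d) in
  let Ul := liou Bs (uchan U) in
  let T := n%:R^-1 *: \sum_(i < n) kron (liou Bs (uchan (Ug i)) *m Pi) (liou Bs (Gt i)) in
  let Delta := T - (p / ipF Ainf^T Binf) *: (vecm Binf *m (vecm Ainf^T)^T) in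
  let a := ipF Ainf^T Ul / normF Pi ^+ 2
           * (Num.sqrt (normF Ainf ^+ 2 / normF Pi ^+ 2))^-1 in
  let b := ipF Ul Binf / normF Pi ^+ 2
           * (Num.sqrt (normF Binf ^+ 2 / normF Pi ^+ 2))^-1 in
  (normF Pi)^-1 *: (vecm (Ul *m Pi))^T
     = (a / normF Ainf) *: (vecm Ainf^T)^T + Num.sqrt (1 - a ^+ 2) *: w^T ->
  (normF Pi)^-1 *: vecm (Ul *m Pi)
     = (b / normF Binf) *: vecm Binf + Num.sqrt (1 - b ^+ 2) *: v ->
  let CU := ipF Pi (Ainf *m Ul) / normF Pi ^+ 2
            * (ipF Pi (Ul^T *m Binf) / normF Pi ^+ 2)
            * (normF Pi ^+ 2 / ipF Pi (Ainf *m Binf)) in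
  forall m : nat, (0 < m)%N ->
    let DmU := Num.sqrt (1 - a ^+ 2) * Num.sqrt (1 - b ^+ 2)
               * (w^T *m mxpow Delta m *m v) 0 0 in
    circuit_fid nu Gt Ug U m
      = (d%:R)^-1 + (d%:R - 1) / d%:R * (CU * p ^+ m + DmU).
Proof.
move=> Pi Ul T Delta a b hzl hzr CU m m0 DmU.
have q0 : ipF Ainf^T Binf != 0 by [].
(* If p = 0 then p^-m = 0 for m > 0, so Binf = 0 and hAB fails. *)
have p0 : p != 0.
  apply/eqP => p0; move/eqP: hAB; apply; rewrite /ipF.
  suff -> : Binf = 0 by rewrite mulmx0 raddf0.
  apply/matrixP => j k; rewrite [RHS]mxE.
  have h1 := hB j k; rewrite -cvg_shiftS in h1.
  apply: (@norm_cvg_unique R R _ _ _ _ h1); apply: cvg_near_cst; near=> i.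
  by rewrite /= p0 expr0n /= invr0 mul0r.
have TB : T *m vecm Binf = p *: vecm Binf.
  apply: (power_limit_eigen (x := vecm Pi) p0) => k.
  under eq_fun do rewrite -twirl_right mxE; rewrite mxE; exact: hB.
have TA : T^T *m vecm Ainf^T = p *: vecm Ainf^T.
  apply: (power_limit_eigen (x := vecm Pi^T) p0) => k.
  under eq_fun do rewrite -twirl_left mxE mxE; rewrite mxE mxE; exact: hA.
have PA : Pi *m Ainf = Ainf.
  apply: (twirl_left_invariant p0 (liou_pitr_sym hBs) _ TA) => i.
  by rewrite -mulmxA (liou_pitr_idem hBs hd).
have TA' : (vecm Ainf^T)^T *m T = p *: (vecm Ainf^T)^T.
  by rewrite -[T]trmxK -trmx_mul TA linearZ.
have zl : ((normF Pi)^-1 *: vecm (Ul *m Pi))^T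
    = (a / normF Ainf) *: (vecm Ainf^T)^T + Num.sqrt (1 - a ^+ 2) *: w^T.
  by rewrite linearZ /= hzl.
(* Here z = vec(U Pi) / ||Pi||. Its products with the two eigenvectors supply the factors of C(U),
   and the remaining term is D(m, U). *)
have := deflate_form q0 (vecm_dot Ainf^T Binf) TB TA' m0 zl hzr.
rewrite -/Delta -/DmU.
have PT : Pi^T = Pi by exact: liou_pitr_sym.
(* The denominators in the two forms of C(U) agree because Pi [Ainf] = [Ainf]. *)
have qE : ipF Pi (Ainf *m Binf) = ipF Ainf^T Binf.
  by rewrite /ipF PT trmxK mulmxA PA.
have zB : (((normF Pi)^-1 *: vecm (Ul *m Pi))^T *m vecm Binf) 0 0
    = (normF Pi)^-1 * ipF Pi (Ul^T *m Binf).
  by rewrite linearZ /= -scalemxAl mxE vecm_dot trmx_mul -mulmxA.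
have Az : ((vecm Ainf^T)^T *m ((normF Pi)^-1 *: vecm (Ul *m Pi))) 0 0
    = (normF Pi)^-1 * ipF Pi (Ainf *m Ul).
  rewrite -scalemxAr mxE vecm_dot trmxK mulmxA mxtrace_mulC.
  by rewrite /ipF PT.
rewrite zB Az.
rewrite (circuit_fid_twirl hBs hd hnu hn hUg hGt hU) -/Pi -/Ul -/T.
set Q := (_ *m vecm (Ul *m Pi)) 0 0.
have -> : (((normF Pi)^-1 *: vecm (Ul *m Pi))^T *m mxpow T m
     *m ((normF Pi)^-1 *: vecm (Ul *m Pi))) 0 0 = (normF Pi ^+ 2)^-1 * Q.
  have -> : ((normF Pi)^-1 *: vecm (Ul *m Pi))^T = (normF Pi)^-1 *: (vecm (Ul *m Pi))^T.
    by rewrite linearZ.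
  by rewrite -!scalemxAl -scalemxAr scalerA mxE -invfM -expr2.
(* This factorization turns the prefactor 1 / (d (d + 1)) into ((d - 1) / d) / ||Pi||^2. *)
have N2 : normF Pi ^+ 2 = (d%:R - 1) * (d%:R + 1).
  by rewrite normF_pitr //; ring.
have d0 : (d%:R : R) != 0 by rewrite pnatr_eq0 -lt0n ltnW.
have d1 : (d%:R + 1 : R) != 0 by rewrite natr1 pnatr_eq0.
have dm1 : (d%:R - 1 : R) != 0 by rewrite subr_eq0 pnatr_eq1 gtn_eqF.
have N0 : normF Pi != 0 by rewrite -sqrf_eq0 N2 mulf_neq0.
move=> hQ; congr (_ + _).
have -> : CU * p ^+ m + DmU = (normF Pi ^+ 2)^-1 * Q.
  by rewrite hQ /CU qE; field; rewrite q0 N0.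
by rewrite N2; field; rewrite d0 d1 dm1.
Unshelve. all: by end_near. Qed.
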